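(* Let $(K,v)$ be a henselian valued field with $v$ non-trivial, and let $a\in K^{\mathrm{sep}}\setminus K$. Assume that $a$ is pure over $K$ and that $(K(a)|K,v)$ is not a tame extension. Set $L:=K(a)\cap K^r$ and assume moreover that $K(a)|L$ is a minimal extension. Then $$\#S_K(a)= \begin{cases} 2 & \text{if } \max v(a-K)\text{ exists and } \max v(a-K)\in S_K(a),\\ 1 & \text{otherwise.}\end{cases}$$
   Context: $\overline{K}$ is a fixed algebraic closure of $K$, $K^{\mathrm{sep}}\subseteq\overline K$ the separable-algebraic closure; the unique extension of $v$ to $\overline K$ is again denoted $v$. $vF$ and $Fv$ denote the value group and residue field of a field $F$ with $K\subseteq F\subseteq\overline K$, and $\deg_F(b)=[F(b):F]$. The characteristic exponent $p$ is $1$ if $\operatorname{char} Kv=0$ and $p=\operatorname{char}Kv$ otherwise. A field extension is minimal if it admits no proper non-trivial subextension. $S_K(a) := \{ v(a-a^\prime) \mid a^\prime\neq a \text{ is a } K\text{-conjugate of } a\}$, and $v(a-K):=\{v(a-z)\mid z\in K\}$. Defect: for a finite extension $(E|K,v)$, $[E:K]=(vE:vK)[Ev:Kv]\,d(E|K,v)$, where the defect $d(E|K,v)$ is a power of $p$. Tame: an algebraic extension $(E|K,v)$ is tame if every finite subextension $(E'|K,v)$ satisfies: $(vE':vK)$ is coprime to $p$, $E'v|Kv$ is separable, and $d(E'|K,v)=1$. $K^r$ (absolute ramification field) is the fixed field in $K^{\mathrm{sep}}$ of $G^r=\{\sigma\in\mathrm{Gal}(\overline K|K)\mid v(\sigma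 x-x)>vx \text{ for all } x\in K^{\mathrm{sep}}\setminus\{0\}\}$. Okutsu sequences and purity: for a positive integer $d<\deg_K(a)$ put $D_d:=\{v(z-a)\mid z\in\overline K,\ \deg_K(z)=d\}$. An Okutsu sequence of $a$ over $K$ is a finite sequence $A_0=\{a\},A_1,\dots,A_n$ of subsets of $\overline K$, all elements of $A_i$ having the same degree $d_i$ over $K$, such that: (OS1) $\deg_K(a)=d_0>d_1>\dots>d_n=1$; (OS2) for all $i\geq1$ and $z\in\overline K$ with $\deg_K(z)<d_{i-1}$ there is $z_i\in A_i$ with $v(a-z_i)\geq v(a-z)$; (OS3) $v(a-z_{i-1})>v(a-z_i)$ for all $i\ge 1$, $z_i\in A_i$, $z_{i-1}\in A_{i-1}$; (OS4) for $i\geq 1$, $\#A_i=1$ if and only if $\max D_{d_i}$ exists, and then $A_i=\{a_i\}$ with $v(a-a_i)=\max D_{d_i}=\max\{v(a-z)\mid \deg_K(z)<d_{i-1}\}$; (OS5) if $\max D_{d_i}$ does not exist, then $A_i=\{z_\nu\}_{\nu<\lambda}$ with $\lambda$ a limit ordinal and $v(a-z_\mu)>v(a-z_\nu)$ for all $\nu<\mu<\lambda$. Every $a\in\overline K\setminus K$ admits an Okutsu sequence, and all its Okutsu sequences have the same length $n$, called the depth $\ell(a)=\ell_K(a)$ of $a$ over $K$. The element $a$ is pure over $K$ if $\ell_K(a)=1$. *)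

(* Defs.v *)
From HB Require Import structures.
From mathcomp Require Import all_boot all_order all_algebra.
From mathcomp Require Import generic_quotient ring_quotient separable.
From mathcomp Require Import mathcomp_extra boolp classical_sets functions.
From mathcomp Require Import cardinality wochoice.

Set Implicit Arguments.
Unset Strict Implicit.
Unset Printing Implicit Defensive.

Import Order.TTheory GRing.Theory Num.Theory.
Local Open Scope classical_set_scope.
Local Open Scope card_scope.
Local Open Scope ring_scope.
Local Open Scope quotient_scope.

HB.mixin Record isOrderedGroup (G : Type) of Num.POrderedZmodule G := {
  og_total : forall x y : G, (x <= y) || (y <= x);
  og_leD2r : forall z x y : G, x <= y -> x + z <= y + z
}.

#[short(type="orderedGroupType")]
HB.structure Definition OrderedGroup :=
  {G of Num.POrderedZmodule G & isOrderedGroup G}.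

Inductive withtop (G : Type) : Type := Fin of G | Infty.
Arguments Infty {G}.

Section WithTop.
Variable G : orderedGroupType.
Implicit Types x y z : withtop G.

Definition withtop_opt x : option G := if x is Fin g then Some g else None.
Definition opt_withtop (o : option G) : withtop G :=
  if o is Some g then Fin g else Infty.

Lemma withtop_optK : cancel withtop_opt opt_withtop.
Proof. by case. Qed.

HB.instance Definition _ := Choice.copy (withtop G) (can_type withtop_optK).

Definition withtop_le x y : bool :=
  match x, y with
  | _, Infty => true
  | Infty, Fin _ => false
  | Fin g, Fin h => g <= h
  end.

Lemma withtop_le_refl : reflexive withtop_le.
Proof. by case=> //= g. Qed.

Lemma withtop_le_anti : antisymmetric withtop_le.
Proof. by case=> [g|] [h|] //= /le_anti ->. Qed.

Lemma withtop_le_trans : transitive withtop_le.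
Proof. by case=> [h|] [g|] [k|] //=; apply: le_trans. Qed.

Lemma withtop_le_total : total withtop_le.
Proof. by case=> [g|] [h|] //=; apply: og_total. Qed.

HB.instance Definition _ := Order.Le_isPOrder.Build ring_display (withtop G)
  withtop_le_refl withtop_le_anti withtop_le_trans.
HB.instance Definition _ :=
  Order.POrder_isTotal.Build ring_display (withtop G) withtop_le_total.

Definition withtop_add x y : withtop G :=
  if x is Fin g then if y is Fin h then Fin (g + h) else Infty else Infty.

Lemma withtop_addA : associative withtop_add.
Proof. by case=> [g|] [h|] [k|] //=; rewrite addrA. Qed.

Lemma withtop_addC : commutative withtop_add.
Proof. by case=> [g|] [h|] //=; rewrite addrC. Qed.

Lemma withtop_add0 : left_id (Fin 0) withtop_add.
Proof. by case=> [g|] //=; rewrite add0r. Qed.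

(* Comparisons with the neutral element must be written with Fin 0: the notation
   0 <= x looks for an ordered zmodType, which withtop G is not. *)
HB.instance Definition _ := GRing.isNmodule.Build (withtop G)
  withtop_addA withtop_addC withtop_add0.

End WithTop.

(* Additive (Krull) valuations of arbitrary rank. The value group of v is the
   set of finite values of v, which may be a proper subgroup of G. *)
Record valuation (M : fieldType) (G : orderedGroupType) := Valuation {
  val_fun :> M -> withtop G;
  val_eq_Infty : forall x, val_fun x = Infty <-> x = 0;
  val_mul : forall x y, val_fun (x * y) = val_fun x + val_fun y;
  val_add : forall x y, Order.min (val_fun x) (val_fun y) <= val_fun (x + y)
}.

Section ResidueField.
Variables (M : fieldType) (G : orderedGroupType) (v : valuation M G).

Lemma val1 : v 1 = Fin 0.
Proof.
have := val_mul v 1 1; rewrite mulr1.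
case E : (v 1) => [g|]; last by move/(val_eq_Infty v)/eqP: E; rewrite oner_eq0.
by move=> [] /eqP; rewrite addrC -subr_eq subrr => /eqP <-.
Qed.

Lemma valN1 : v (-1) = Fin 0.
Proof.
have := val_mul v (-1) (-1); rewrite mulrNN mulr1 val1.
case: (v (-1)) => [g|] //= [] h.
congr Fin; apply/le_anti.
case/orP: (og_total g 0) => hg; have := og_leD2r g _ _ hg; rewrite -h add0r hg.
  by move=> ->.
by move=> ->.
Qed.

Lemma valN x : v (- x) = v x.
Proof. by rewrite -mulN1r val_mul valN1 add0r. Qed.

Definition val_ring : {pred M} := fun x => Fin 0 <= v x.

Lemma withtop_addr_ge0 (g h : withtop G) :
  Fin 0 <= g -> Fin 0 <= h -> Fin 0 <= g + h.
Proof.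
case: g => [g|] //; case: h => [h|] // g0 h0.
apply: le_trans (h0 : _ <= Fin h) _.
by have := og_leD2r h _ _ (g0 : (0 : G) <= g); rewrite add0r.
Qed.

Lemma withtop_addr_gt0 (g h : withtop G) :
  Fin 0 <= g -> Fin 0 < h -> Fin 0 < g + h.
Proof.
case: g => [g|] //; case: h => [h|] // g0 h0.
apply: (lt_le_trans (h0 : _ < Fin h)).
by have := og_leD2r h _ _ (g0 : (0 : G) <= g); rewrite add0r.
Qed.

Lemma val_ring_subring : subring_closed val_ring.
Proof.
split; rewrite /val_ring ?unfold_in.
- by rewrite val1.
- move=> x y x0 y0; apply: le_trans (val_add v _ _).
  by rewrite le_min valN; apply/andP.
- by move=> x y x0 y0; rewrite unfold_in val_mul; apply: withtop_addr_ge0.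
Qed.

HB.instance Definition _ :=
  GRing.isSubringClosed.Build M val_ring val_ring_subring.

Record valuation_ring := ValuationRing {
  vr_val :> M;
  vr_valP : vr_val \in val_ring
}.

HB.instance Definition _ := [isSub for vr_val].
HB.instance Definition _ := [Choice of valuation_ring by <:].
HB.instance Definition _ :=
  [SubChoice_isSubComNzRing of valuation_ring by <:].

Definition max_ideal : {pred valuation_ring} := fun x => Fin 0 < v (vr_val x).

Lemma max_ideal_closed : idealr_closed max_ideal.
Proof.
split.
- rewrite unfold_in /= (_ : v 0 = Infty) //; exact/val_eq_Infty.
- by rewrite unfold_in /= val1 ltxx.
- move=> a x y; rewrite !unfold_in /= => x0 y0.
  apply: lt_le_trans (val_add v _ _).
  by rewrite lt_min y0 val_mul withtop_addr_gt0 //; exact: (vr_valP a).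
Qed.

HB.instance Definition _ :=
  isIdealr.Build valuation_ring max_ideal max_ideal_closed.

Definition residue_field := {ideal_quot max_ideal}.

HB.instance Definition _ := GRing.ComNzRing.on residue_field.

Definition residue : valuation_ring -> residue_field := \pi_residue_field.

Definition residue_inv (x : residue_field) : residue_field :=
  if x == 0 then 0 else residue (insubd 0 (vr_val (repr x))^-1).

Lemma residue_mulVx x : x != 0 -> residue_inv x * x = 1.
Proof.
move=> x0; rewrite /residue_inv (negPf x0) -{2}[x]reprK.
set y := repr x.
have vy : v (vr_val y) = Fin 0.
  have := x0; rewrite -[x]reprK -/y -(rmorph0 \pi_residue_field).
  rewrite -Quotient.idealrBE subr0 unfold_in -leNgt => yle.
  by apply/le_anti; rewrite yle; exact: (vr_valP y).
have yn0 : vr_val y != 0.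
  by apply/eqP => /(val_eq_Infty v); rewrite vy.
have viy : v (vr_val y)^-1 = Fin 0.
  have := val_mul v (vr_val y)^-1 (vr_val y).
  by rewrite mulVf // val1 vy -[Fin 0]/(0 : withtop G) addr0.
rewrite /residue -rmorphM -(rmorph1 \pi_residue_field).
congr (\pi _); apply: val_inj => /=.
rewrite insubdK ?mulVf //.
by change (is_true (Fin 0 <= v (vr_val y)^-1)); rewrite viy.
Qed.

Lemma residue_inv0 : residue_inv 0 = 0.
Proof. by rewrite /residue_inv eqxx. Qed.

HB.instance Definition _ :=
  GRing.ComNzRing_isField.Build residue_field residue_mulVx residue_inv0.

End ResidueField.

Section Subfields.
Variable M : fieldType.
Implicit Types (F E : set M) (a x : M) (p : {poly M}).

Definition is_subfield F : Prop :=
  [/\ F 1, forall x y, F x -> F y -> F (x - y)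
    & forall x y, F x -> F y -> F (x / y)].

Definition poly_over F : set {poly M} := [set p | forall i, F p`_i].

Definition is_algebraic F x : Prop :=
  exists p, [/\ poly_over F p, p != 0 & root p x].

(* By convention 0 when x is transcendental over F. *)
Definition minpoly F x : {poly M} :=
  xget 0 [set p | [/\ poly_over F p, p \is monic, root p x
    & forall q, poly_over F q -> q != 0 -> root q x -> (size p <= size q)%N]].

Definition conjugate F x y : Prop := root (minpoly F x) y.

Definition separable_over F x : Prop := separable_poly (minpoly F x).

Definition adjoin F a : set M :=
  [set x | forall E, is_subfield E -> F `<=` E -> E a -> E x].

Definition is_basis F E n (b : 'I_n -> M) : Prop :=
  (forall i, E (b i)) /\
  forall x, E x ->
    exists! c : 'I_n -> M, (forall i, F (c i)) /\ x = \sum_i c i * b i.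

Definition finite_extension F E : Prop := exists n (b : 'I_n -> M), is_basis F E b.

(* [E : F], by convention 0 when the extension is infinite. *)
Definition ext_degree F E : nat :=
  xget 0%N [set n | exists b : 'I_n -> M, is_basis F E b].

Definition elt_degree F x : nat := ext_degree F (adjoin F x).

Definition minimal_extension F E : Prop :=
  forall N, is_subfield N -> F `<=` N -> N `<=` E -> N = F \/ N = E.

Definition separable_closure F : set M :=
  [set x | is_algebraic F x /\ separable_over F x].

Definition field_automorphism F (s : {rmorphism M -> M}) : Prop :=
  bijective s /\ forall x, F x -> s x = x.

End Subfields.

Definition is_max (d : Order.disp_t) (T : porderType d) (A : set T) (m : T) :=
  A m /\ forall x, A x -> (x <= m)%O.

Definition char_exponent (k : fieldType) : nat :=
  xget 1%N [set p | p \in [pchar k]].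

Section ValuedFields.
Variables (M : fieldType) (G : orderedGroupType) (v : valuation M G).
Implicit Types (K E : set M) (a : M).

Definition value_group E : set G := [set g | exists2 x, E x & v x = Fin g].

(* (vE : vK) is the number of cosets of vK in vE, by convention 0 when this
   number is infinite. *)
Definition ramification_index K E : nat :=
  let coset g := [set g + h | h in value_group K] in
  xget 0%N [set n | [set coset g | g in value_group E] #= `I_n].

(* E v, as a subfield of the residue field of M. *)
Definition residue_subfield E : set (residue_field v) :=
  [set residue x | x in [set x : valuation_ring v | E (vr_val x)]].

Definition inertia_degree K E : nat :=
  ext_degree (residue_subfield K) (residue_subfield E).

Definition has_defect K E (d : nat) : Prop :=
  ext_degree K E = (ramification_index K E * inertia_degree K E * d)%N.

(* All the residue fields E v have the same characteristic as M v. *)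
Definition tame_extension K E : Prop :=
  forall E', is_subfield E' -> K `<=` E' -> E' `<=` E -> finite_extension K E' ->
  [/\ coprime (ramification_index K E') (char_exponent (residue_field v)),
      forall x, residue_subfield E' x -> separable_over (residue_subfield K) x
    & has_defect K E' 1].

Definition nontrivial_on K : Prop :=
  exists2 x, K x & v x <> Infty /\ v x <> Fin 0.

(* The restriction of v to K has a unique extension to M, two valuations being
   identified when they have the same valuation ring. *)
Definition henselian K : Prop :=
  forall (H : orderedGroupType) (w : valuation M H),
    (forall x, K x -> (Fin 0 <= w x) = (Fin 0 <= v x)) ->
    forall x, (Fin 0 <= w x) = (Fin 0 <= v x).

Definition in_ramification_group K (s : {rmorphism M -> M}) : Prop :=
  field_automorphism K s /\
  forall x, separable_closure K x -> x != 0 -> v x < v (s x - x).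

Definition ramification_field K : set M :=
  [set x | separable_closure K x /\
           forall s, in_ramification_group K s -> s x = x].

Definition conj_distances K a : set (withtop G) :=
  [set v (a - b) | b in [set b | conjugate K a b /\ b <> a]].

Definition distances K a : set (withtop G) := [set v (a - z) | z in K].

Definition degree_distances K a (d : nat) : set (withtop G) :=
  [set v (z - a) | z in [set z | elt_degree K z = d]].

Definition has_max_degree_distance K a d : Prop :=
  exists m, is_max (degree_distances K a d) m.

(* A is of the form {z_i}_{i < lambda} with lambda a limit ordinal and v (a - z_i)
   strictly increasing; an ordinal is given by a well-ordered type I. *)
Definition limit_enumeration a (A : set M) : Prop :=
  exists (d : Order.disp_t) (I : orderType d) (z : I -> M),
  [/\ well_order (fun i j : I => (i <= j)%O),
      inhabited I /\ (forall i : I, exists j, (i < j)%O),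
      A = range z
    & forall i j : I, (i < j)%O -> v (a - z i) < v (a - z j)].

(* Only the values A i and d i with i <= n matter. *)
Record okutsu_sequence K a (n : nat) (A : nat -> set M) (d : nat -> nat) :
    Prop := OkutsuSequence {
  okutsu_start : A 0%N = [set a];
  okutsu_degree : forall i z, (i <= n)%N -> A i z -> elt_degree K z = d i;
  okutsu_OS1 : [/\ d 0%N = elt_degree K a,
    forall i, (i < n)%N -> (d i.+1 < d i)%N & d n = 1%N];
  okutsu_OS2 : forall i z, (i < n)%N -> (elt_degree K z < d i)%N ->
    exists2 y, A i.+1 y & v (a - z) <= v (a - y);
  okutsu_OS3 : forall i y z, (i < n)%N -> A i y -> A i.+1 z ->
    v (a - z) < v (a - y);
  okutsu_OS4 : forall i, (i < n)%N ->
    (A i.+1 #= `I_1 <-> has_max_degree_distance K a (d i.+1)) /\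
    (has_max_degree_distance K a (d i.+1) ->
     exists y, [/\ A i.+1 = [set y],
       is_max (degree_distances K a (d i.+1)) (v (a - y))
     & is_max [set v (a - z) | z in [set z | (elt_degree K z < d i)%N]]
              (v (a - y))]);
  okutsu_OS5 : forall i, (i < n)%N ->
    ~ has_max_degree_distance K a (d i.+1) -> limit_enumeration a (A i.+1)
}.

(* All Okutsu sequences of a over K have the same length. *)
Definition depth K a : nat :=
  xget 0%N [set n | exists A d, okutsu_sequence K a n A d].

Definition pure K a : Prop := depth K a = 1%N.

End ValuedFields.

(* Main.v *)
From HB Require Import structures.
Require Import Defs.
From mathcomp Require Import all_boot all_order all_algebra.
From mathcomp Require Import separable.
From mathcomp Require fingroup pgroup finalg.
From mathcomp Require Import boolp classical_sets functions cardinality.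

(** Let G^r be the ramification group and call s trivial on E if
    v (s x - x) > v x for all nonzero x in E.

    1. An automorphism s that is trivial on an intermediate field E agrees on E
       with an element of G^r, so it fixes E ∩ K^r. By Zorn's lemma, extend the
       partial embedding s|E as long as it stays trivial. At a maximal domain F,
       every x has the leading term of an element of F: otherwise adjoin the root
       near x of a polynomial of least degree over F in whose value at x the
       leading terms cancel. Then any extension of the embedding to Kbar is
       trivial, because automorphisms are isometries.
    2. Purity: if s a is closer to a than every c in K, then f (s a) / f (a) is a
       1-unit for every f in K[X] of degree < deg a, by factoring f over Kbar. So s
       is trivial on K(a) and fixes L. Hence if s does not fix L, then v (s a - a)
       is the maximum of v (a - K).
    3. Minimality of K(a)|L: the automorphisms over L with v (s a - a) >= g form a
       group, so v (s a - a) takes at most one value g0 on those moving a.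
    4. If G^r fixes a, then K(a)|K is tame. For E in K(a) of degree n there are n
       embeddings s_j of E, with distinct characters x |-> res (s_j x / x) by 1.
       Dedekind's independence of characters gives x_1, ..., x_n in E with
       det (res (s_j x_i / x_i)) <> 0. This makes (x_i), and by Frobenius also
       (x_i ^ p), valuation bases of E|K, whence [E : K] = e f, p does not divide e,
       and the residue extension is separable.
    By 4 some t in G^r moves a, so g0 exists; it exceeds all of v (a - K). Thus
    S_K(a) is {g0} or {g0, max v (a - K)}. *)

Set Implicit Arguments.
Unset Strict Implicit.
Unset Printing Implicit Defensive.
Import Order.TTheory GRing.Theory.
Local Open Scope classical_set_scope.
Local Open Scope card_scope.
Local Open Scope ring_scope.

(** * Subfields, minimal polynomials, bases *)

Section SubfieldType.
Variables (M : fieldType) (E : set M) (sfE : is_subfield E).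

Lemma sf1 : E 1. Proof. by case: sfE. Qed.
Lemma sfB x y : E x -> E y -> E (x - y). Proof. by case: sfE => _ + _; apply. Qed.
Lemma sf0 : E 0. Proof. by rewrite -(subrr 1); apply: sfB; apply: sf1. Qed.
Lemma sfN x : E x -> E (- x). Proof. by rewrite -sub0r; apply: sfB; apply: sf0. Qed.
Lemma sfD x y : E x -> E y -> E (x + y).
Proof. by move=> Ex Ey; rewrite -[y]opprK; apply: sfB => //; apply: sfN. Qed.
Lemma sf_div x y : E x -> E y -> E (x / y).
Proof. by case: sfE => _ _; apply. Qed.
Lemma sfV x : E x -> E x^-1.
Proof. by rewrite -[x^-1]mul1r; apply: sf_div; apply: sf1. Qed.
Lemma sfM x y : E x -> E y -> E (x * y).
Proof. by move=> Ex Ey; rewrite -[y]invrK; apply: sf_div => //; apply: sfV. Qed.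
Lemma sfX x n : E x -> E (x ^+ n).
Proof.
by move=> Ex; elim: n => [|n IH]; rewrite ?exprS; [apply: sf1|apply: sfM].
Qed.
Lemma sf_sum (I : Type) (r : seq I) (P : pred I) (F : I -> M) :
  (forall i, P i -> E (F i)) -> E (\sum_(i <- r | P i) F i).
Proof. by move=> EF; elim/big_ind: _ => //; [apply: sf0|apply: sfD]. Qed.

Definition sf_pred (_ : is_subfield E) : {pred M} := fun x => `[< E x >].
Local Notation S := (sf_pred sfE).

Lemma sf_pred_divring : divring_closed S.
Proof.
split=> [|x y /asboolP Ex /asboolP Ey|x y /asboolP Ex /asboolP Ey];
  apply/asboolP; [exact: sf1|exact: sfB|exact: sf_div].
Qed.

HB.instance Definition _ := GRing.isDivringClosed.Build M S sf_pred_divring.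

(** As a field type, the subfield supports polynomial division and matrix rank over [E]. *)
Record sf_type := SfType { sf_val :> M; sf_valP : sf_val \in S }.
HB.instance Definition _ := [isSub for sf_val].
HB.instance Definition _ := [Choice of sf_type by <:].
HB.instance Definition _ := [SubChoice_isSubIntegralDomain of sf_type by <:].
HB.instance Definition _ := [SubIntegralDomain_isSubField of sf_type by <:].

Lemma sf_val_is_zmod_morphism : zmod_morphism sf_val.
Proof. exact: (rmorphB (\val : sf_type -> M)). Qed.
Lemma sf_val_is_monoid_morphism : monoid_morphism sf_val.
Proof. by split; [exact: (rmorph1 (\val : sf_type -> M))|exact: (rmorphM (\val : sf_type -> M))]. Qed.
HB.instance Definition _ :=
  GRing.isZmodMorphism.Build sf_type M sf_val sf_val_is_zmod_morphism.
HB.instance Definition _ :=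
  GRing.isMonoidMorphism.Build sf_type M sf_val sf_val_is_monoid_morphism.

Lemma sf_val_inj : injective sf_val. Proof. exact: val_inj. Qed.

Definition sf_in x (Ex : E x) : sf_type := SfType (asboolT Ex : x \in S).

Lemma sf_val_in (c : sf_type) : E (sf_val c).
Proof. by apply/asboolP; exact: (valP c). Qed.

Lemma sf_lift (I : Type) (f : I -> M) : (forall i, E (f i)) ->
  exists g : I -> sf_type, forall i, sf_val (g i) = f i.
Proof. by move=> Ef; exists (fun i => sf_in (Ef i)). Qed.

Local Notation "p ^v" := (map_poly sf_val p) (at level 2, format "p ^v").

Lemma poly_overP (p : {poly M}) :
  poly_over E p <-> exists q : {poly sf_type}, p = q^v.
Proof.
split=> [Ep|[q ->] i]; last by rewrite coef_map; apply: sf_val_in.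
exists (\poly_(i < size p) sf_in (Ep i)); apply/polyP => i.
rewrite coef_map coef_poly /=; case: ltnP => //= h.
by rewrite nth_default.
Qed.

(** Euclidean division by a polynomial of least size vanishing at [x] leaves remainder 0, so it
    divides all others. Its monic multiple is the only polynomial that the choice in [minpoly] can
    return. *)
Lemma minpoly_sfP x : is_algebraic E x ->
  exists p : {poly sf_type}, [/\ minpoly E x = p^v, p \is monic &
    forall q : {poly sf_type}, root q^v x = (p %| q)].
Proof.
move=> -[p0 [/poly_overP [q0 ->] q00 rq0]].
rewrite map_poly_eq0 in q00.
pose Q n := `[< exists q : {poly sf_type}, [/\ q != 0, root q^v x & size q = n] >].
have exS : exists n, Q n by exists (size q0); apply/asboolP; exists q0.
case: (ex_minnP exS) => n /asboolP [q [qn0 rq <-]] mn.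
have {}mn r : r != 0 -> root r^v x -> (size q <= size r)%N.
  by move=> rn0 rr; apply: mn; apply/asboolP; exists r.
have dvd r : root r^v x -> q %| r.
  move=> rr; rewrite /dvdp; case: eqVneq => // rem0.
  have : root (r %% q)^v x.
    have := rr; rewrite !rootE {1}(divp_eq r q) rmorphD rmorphM hornerD hornerM.
    by rewrite (rootP rq) mulr0 add0r.
  by move=> /(mn _ rem0); rewrite leqNgt ltn_modp qn0.
pose p := (lead_coef q)^-1 *: q.
have lq0 : (lead_coef q)^-1 != 0 by rewrite invr_eq0 lead_coef_eq0.
have pq : p %= q by rewrite eqp_scale.
have pm : p \is monic by rewrite monicE lead_coefZ mulVf // -invr_eq0.
have rp : root p^v x by rewrite map_polyZ rootZ // fmorph_eq0.
have szp : size p = size q by rewrite size_scale.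
clearbody p => {lq0}.
exists p; split => //; last first.
  move=> r; rewrite (eqp_dvdl _ pq); apply/idP/idP; first exact: dvd.
  by case/dvdpP => u ->; rewrite rmorphM rootM rq orbT.
rewrite /minpoly; apply: xget_unique.
  split; first by apply/poly_overP; exists p.
  - by rewrite map_monic.
  - by [].
  - move=> _ /poly_overP [r ->]; rewrite map_poly_eq0 => r0 /(mn _ r0).
    by rewrite !size_map_poly szp.
move=> _ [/poly_overP [r ->]] rm rr rmin; congr (map_poly _ _).
have szr : size r = size q.
  apply/eqP; rewrite eqn_leq mn ?andbT //; last by rewrite -(map_poly_eq0 sf_val) monic_neq0.
  have := rmin _ _ _ rq; rewrite !size_map_poly map_poly_eq0; apply => //.
  by apply/poly_overP; exists q.
have : p %= r.
  by rewrite -dvdp_size_eqp ?szr ?szp // (eqp_dvdl _ pq) dvd.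
move=> /eqpP /sig2_eqW [[c d] /= /andP [c0 d0] cd].
have := congr1 lead_coef cd; rewrite !lead_coefZ (monicP pm).
rewrite map_monic in rm; rewrite (monicP rm) !mulr1 => cd'.
by apply: (scalerI c0); rewrite cd cd'.
Qed.
End SubfieldType.

(** * Linear independence and dimension over a subfield *)

Section Bases.
Variables (M : fieldType) (F : set M) (sfF : is_subfield F).
Local Notation sT := (sf_type sfF).
Local Notation "A ^v" := (map_mx (@sf_val M F sfF) A) (at level 2, format "A ^v").

Lemma sf_mx m n (A : 'M[M]_(m, n)) : (forall i j, F (A i j)) ->
  exists B : 'M[sT]_(m, n), A = B^v.
Proof.
move=> FA; exists (\matrix_(i, j) sf_in sfF (FA i j)).
by apply/matrixP => i j; rewrite !mxE.
Qed.

Definition lin_indep n (b : 'I_n -> M) : Prop :=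
  forall c : 'I_n -> M, (forall i, F (c i)) -> \sum_i c i * b i = 0 ->
  forall i, c i = 0.

Definition spans (E : set M) n (b : 'I_n -> M) : Prop :=
  forall x, E x -> exists2 c : 'I_n -> M, forall i, F (c i) & x = \sum_i c i * b i.

Lemma is_basisP E n (b : 'I_n -> M) : E 0 ->
  is_basis F E b <-> [/\ forall i, E (b i), lin_indep b & spans E b].
Proof.
move=> E0; split=> [[Eb H]|[Eb li sp]].
  split=> //.
    move=> c Fc c0 i; have [d [_ uq]] := H 0 E0.
    rewrite -(uq c) // (uq (fun=> 0)) //; split; first by move=> _; apply: sf0.
    by rewrite big1 // => j _; rewrite mul0r.
  by move=> x /H [c [[Fc cx] _]]; exists c.
split=> // x /sp [c Fc cx]; exists c; split=> // d [Fd dx]; apply/funext => i.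
apply/eqP; rewrite -subr_eq0; apply/eqP.
apply: (li (fun i => c i - d i)) => [j|]; first exact: sfB.
rewrite (eq_bigr (fun j => c j * b j - d j * b j)) => [|j _]; last by rewrite mulrBl.
by rewrite sumrB -cx -dx subrr.
Qed.

(** The coordinates of the [b i] with respect to [c] form a matrix with [n] free rows and [m]
    columns. *)
Lemma indep_le_span n m (b : 'I_n -> M) (c : 'I_m -> M) E :
  (forall i, E (b i)) -> lin_indep b -> spans E c -> (n <= m)%N.
Proof.
move=> Eb li sp.
have /choice [g gP] : forall i, exists g : 'I_m -> M,
    (forall j, F (g j)) /\ b i = \sum_j g j * c j.
  by move=> i; have [g] := sp _ (Eb i); exists g.
have [B BE] : exists B : 'M[sT]_(n, m), \matrix_(i, j) g i j = B^v.
  by apply: sf_mx => i j; rewrite mxE; apply: (gP i).1.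
suff : row_free B by move=> /eqP <-; apply: rank_leq_col.
rewrite -kermx_eq0; apply/eqP/row_matrixP => i; rewrite row0.
set u := row i _; have uB : u *m B = 0 by rewrite /u -row_mul mulmx_ker row0.
apply/rowP => j; rewrite [RHS]mxE; apply: sf_val_inj; rewrite rmorph0.
apply: (li (fun j => sf_val (u 0 j))) => [k|]; first exact: sf_val_in.
rewrite (eq_bigr (fun i => \sum_j (sf_val (u 0 i) * g i j) * c j)); last first.
  by move=> k _; rewrite (gP k).2 mulr_sumr; apply: eq_bigr => l _; rewrite mulrA.
rewrite /= exchange_big big1 //= => l _; rewrite -mulr_suml.
have := congr1 (fun A : 'M[M]__ => A 0 l) (congr1 (map_mx (@sf_val M F sfF)) uB).
rewrite map_mxM -BE map_mx0 !mxE => h; rewrite [X in X * _](_ : _ = 0) ?mul0r //.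
by rewrite -[RHS]h; apply: eq_bigr => k _; rewrite !mxE.
Qed.

Lemma basis_size E n m (b : 'I_n -> M) (c : 'I_m -> M) : E 0 ->
  is_basis F E b -> is_basis F E c -> n = m.
Proof.
move=> E0 /(is_basisP b E0) [Eb lb sb] /(is_basisP c E0) [Ec lc sc].
apply/eqP; rewrite eqn_leq (indep_le_span Eb lb sc).
by rewrite (indep_le_span Ec lc sb).
Qed.

Lemma ext_degreeE E n (b : 'I_n -> M) : E 0 -> is_basis F E b -> ext_degree F E = n.
Proof.
move=> E0 bb; rewrite /ext_degree; apply: xget_unique; first by exists b.
by move=> m [c bc]; apply: (basis_size E0 bc bb).
Qed.

(** Appending [x] to [b] gives [n.+1] elements of a space spanned by [n], hence a relation. Its
    coefficient at [x] is nonzero since [b] is independent, so it can be solved for [x]. *)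
Lemma indep_spans E n (b c : 'I_n -> M) :
  (forall x y, E x -> E y -> E (x + y)) -> (forall x y, F x -> E y -> E (x * y)) -> E 0 ->
  spans E c -> (forall i, E (b i)) -> lin_indep b -> spans E b.
Proof.
move=> ED EZ E0 sp Eb li x Ex.
pose b' (i : 'I_n.+1) := if unlift ord_max i is Some j then b j else x.
have b'l i : b' (widen_ord (leqnSn n) i) = b i.
  rewrite /b' (_ : widen_ord _ i = lift ord_max i) ?liftK //.
  by apply: val_inj; rewrite /= /bump leqNgt ltn_ord.
have b'm : b' ord_max = x by rewrite /b' unlift_none.
have Eb' i : E (b' i) by rewrite /b'; case: unlift.
have : ~ lin_indep b' by move=> /(indep_le_span Eb') /(_ sp); rewrite ltnn.
move=> /existsNP [d /not_implyP [Fd /not_implyP [d0 /existsNP [i /eqP di]]]].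
move: d0; rewrite big_ord_recr /= b'm => d0.
have {}d0 : \sum_i d (widen_ord (leqnSn n) i) * b i + d ord_max * x = 0.
  by rewrite -[RHS]d0; congr (_ + _); apply: eq_bigr => j _; rewrite b'l.
have [dm|dm] := eqVneq (d ord_max) 0.
  case/eqP: di; move: d0; rewrite dm mul0r addr0 => d0.
  have h := li (fun i => d (widen_ord (leqnSn n) i)) (fun i => Fd _) d0.
  case: (unliftP ord_max i) => [j ->|-> //].
  rewrite -(h j); congr d; apply: val_inj; rewrite /= /bump leqNgt ltn_ord //.
exists (fun i => - (d (widen_ord (leqnSn n) i) / d ord_max)).
  by move=> j; apply: sfN => //; apply: sf_div.
apply: (mulfI dm); rewrite mulr_sumr -[LHS](addKr (\sum_(i < n) d (widen_ord (leqnSn n) i) * b i)).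
rewrite d0 addr0 -sumrN; apply: eq_bigr => j _.
by rewrite mulNr mulrN mulrA; congr (- (_ * _)); rewrite mulrC divfK.
Qed.

End Bases.

(** * Simple algebraic extensions *)

Lemma adjoin_subfield (M : fieldType) (K : set M) a : is_subfield (adjoin K a).
Proof.
split=> [E sE _ _|x y Ax Ay E sE KE Ea|x y Ax Ay E sE KE Ea].
- exact: sf1.
- by apply: sfB => //; [apply: Ax|apply: Ay].
- by apply: sf_div => //; [apply: Ax|apply: Ay].
Qed.

Lemma sub_adjoin (M : fieldType) (K : set M) a : K `<=` adjoin K a.
Proof. by move=> x Kx E _ KE _; apply: KE. Qed.

Lemma mem_adjoin (M : fieldType) (K : set M) a : adjoin K a a.
Proof. by move=> E. Qed.

Section Simple.
Variables (M : fieldType) (K : set M) (sfK : is_subfield K).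
Variables (a : M) (alg : is_algebraic K a).
Local Notation sT := (sf_type sfK).
Local Notation "p ^v" := (map_poly (@sf_val M K sfK) p) (at level 2, format "p ^v").

Lemma sf_horner (q : {poly sT}) (E : set M) : is_subfield E -> K `<=` E -> E a -> E (q^v).[a].
Proof.
move=> sE KE Ea; rewrite horner_coef; apply: sf_sum => // i _.
apply: sfM => //; last exact: sfX.
by rewrite coef_map; exact: (KE _ (sf_val_in _)).
Qed.

(** The values at [a] of polynomials over [K] already form a field: a Bezout relation with the
    minimal polynomial inverts any nonzero value. *)
Lemma adjoinP x : adjoin K a x <-> exists q : {poly sT}, x = (q^v).[a].
Proof.
have [p [_ pm pP]] := minpoly_sfP sfK alg.
split; last by move=> [q ->] E sE KE Ea; apply: sf_horner.
have ra : root p^v a by rewrite pP.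
pose A := [set x | exists q : {poly sT}, x = (q^v).[a]].
move=> Ax; apply: (Ax A); first split.
- by exists 1; rewrite rmorph1 hornerC.
- by move=> _ _ [q ->] [r ->]; exists (q - r); rewrite rmorphB hornerD hornerN.
- move=> _ _ [q ->] [r ->]; have [r0|r0] := eqVneq (r^v).[a] 0.
    by exists 0; rewrite r0 invr0 mulr0 rmorph0 horner0.
  (* Write [p] as [e] times the gcd. The gcd does not vanish at [a] because [r] does not, so [e]
     does; then [p] divides [e] and the gcd is constant. *)
  have /Bezout_coprimepP [[u w] /= ] : coprimep p r.
    rewrite /coprimep; have := dvdp_gcdl p r; case/dvdpP => e pe.
    have e0 : e != 0 by apply: contraTneq pm => e0; rewrite pe e0 mul0r monicE lead_coef0 eq_sym oner_eq0.
    have d0 : gcdp p r != 0 by rewrite gcdp_eq0 (negPf (monic_neq0 pm)).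
    have : root (e * gcdp p r)^v a by rewrite -pe.
    rewrite rmorphM rootM => /orP [|]; rewrite pP => h; last first.
      by move: r0; rewrite -rootE pP (dvdp_trans h (dvdp_gcdr p r)).
    move/dvdp_leq: (h) => /(_ e0); rewrite {1}pe size_mul // => sz.
    rewrite eqn_leq size_poly_gt0 d0 andbT.
    by move: sz; rewrite -subn1 leq_subLR addnC leq_add2r.
  rewrite -size_poly_eq1 => /size_poly1P [c c0 uw].
  have [d dE] : exists d : sT, sf_val d = (sf_val c)^-1 by exists c^-1; rewrite fmorphV.
  exists (q * w * d%:P).
  have := congr1 (fun s => (s^v).[a]) uw.
  rewrite /= map_polyC hornerC rmorphD !rmorphM hornerD !hornerM (rootP ra) mulr0 add0r /= => wr.
  rewrite map_polyC hornerC /= dE -mulrA; congr (_ * _).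
  by rewrite -wr invfM mulrA mulfV ?mul1r //; apply: contraNneq c0 => w0;
     rewrite -(fmorph_eq0 (@sf_val M K sfK)) /= -wr w0 mul0r.
- by move=> y Ky; exists (sf_in sfK Ky)%:P; rewrite map_polyC hornerC.
- by exists 'X; rewrite map_polyX hornerX.
Qed.

Lemma adjoin_basis :
  is_basis K (adjoin K a) (fun i : 'I_(size (minpoly K a)).-1 => a ^+ i).
Proof.
have [p [-> pm pP]] := minpoly_sfP sfK alg; rewrite size_map_poly.
have sz : (size p).-1.+1 = size p by rewrite prednK // size_poly_gt0 monic_neq0.
apply/(is_basisP sfK) => //; first exact: (sf0 (adjoin_subfield K a)).
split=> [i|c Kc c0 i|x /adjoinP [q ->]].
- exact: (sfX (adjoin_subfield K a) _ (@mem_adjoin M K a)).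
- have [d dc] := sf_lift sfK Kc.
  pose q := \poly_(i < (size p).-1) (if insub i is Some j then d j else 0).
  have : root q^v a.
    rewrite rootE (@horner_coef_wide _ (size p).-1) ?size_map_poly ?size_poly //.
    apply/eqP; rewrite -[RHS]c0; apply: eq_bigr => j _.
    by rewrite coef_map coef_poly ltn_ord valK /= dc.
  rewrite pP => pq; have q0 : q = 0.
    apply/eqP; apply: contraTT pq => q0; apply/negP => /dvdp_leq -/(_ q0).
    by rewrite leqNgt -sz ltnS size_poly.
  have := congr1 (fun s : {poly sT} => s`_i) q0.
  by rewrite coef_poly ltn_ord valK coef0 -dc => ->; rewrite rmorph0.
- exists (fun i => (q %% p)^v`_i).
    by move=> i; rewrite coef_map; apply: sf_val_in.
  have ra : root p^v a by rewrite pP.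
  rewrite {1}(divp_eq q p) rmorphD rmorphM hornerD hornerM (rootP ra) mulr0 add0r.
  rewrite (@horner_coef_wide _ (size p).-1) // size_map_poly -ltnS sz ltn_modp.
  exact: monic_neq0.
Qed.

Lemma elt_degreeE : elt_degree K a = (size (minpoly K a)).-1.
Proof.
by rewrite /elt_degree (ext_degreeE sfK _ adjoin_basis) //; exact: (sf0 (adjoin_subfield K a)).
Qed.

Lemma minpoly_size_gt1 : (1 < size (minpoly K a))%N.
Proof.
have [p [-> pm pP]] := minpoly_sfP sfK alg; rewrite size_map_poly.
have : root p^v a by rewrite pP.
rewrite ltnNge; apply: contraL => /size1_polyC pc.
rewrite {1}pc map_polyC rootC fmorph_eq0; apply: contraTneq pm => p0.
by rewrite pc p0 monicE lead_coef0 eq_sym oner_eq0.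
Qed.

Lemma elt_degree_le (q : {poly sT}) : q != 0 -> root q^v a -> (elt_degree K a <= (size q).-1)%N.
Proof.
have [p [pE pm pP]] := minpoly_sfP sfK alg.
move=> q0; rewrite pP elt_degreeE pE size_map_poly => /dvdp_leq -/(_ q0) le.
by rewrite -!subn1 leq_sub2r.
Qed.

Lemma elt_degree1 : elt_degree K a = 1%N -> K a.
Proof.
have [p [pE pm pP]] := minpoly_sfP sfK alg.
have ra : root p^v a by rewrite pP.
rewrite elt_degreeE pE size_map_poly => sz.
have sz2 : size p = 2%N by rewrite -sz prednK // size_poly_gt0 monic_neq0.
move: ra; rewrite rootE horner_coef size_map_poly sz2 !big_ord_recl big_ord0 /= addr0 !coef_map /=.
have := monicP pm; rewrite /lead_coef sz2 /= => ->; rewrite rmorph1 mul1r expr0 expr1 mulr1.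
by rewrite addr_eq0 => /eqP/(congr1 -%R); rewrite opprK => <-; apply: sfN => //; apply: sf_val_in.
Qed.

Lemma conjugate_root (q : {poly sT}) b : root q^v a -> conjugate K a b -> root q^v b.
Proof.
have [p [pE pm pP]] := minpoly_sfP sfK alg.
rewrite pP /conjugate pE => /dvdpP [u ->] rb.
by rewrite rmorphM rootM rb orbT.
Qed.

End Simple.

(** * Partial embeddings *)

Section Graphs.
Variables (M : closedFieldType) (K : set M) (sfK : is_subfield K).
Hypothesis alg : forall x, is_algebraic K x.

(* A partial embedding over K is represented by its graph, a subring of M * M. This
   makes unions of chains trivial, and a polynomial over this ring carries at once
   a polynomial over the domain and its image under the embedding. *)
Definition is_subgraph (g : set (M * M)) : Prop :=
  [/\ g (1, 1), forall c, K c -> g (c, c), forall u w, g u -> g w -> g (u - w)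
    & forall u w, g u -> g w -> g (u * w)].

(** The relation [P] is the invariant kept while the domain grows: [functional_at] for plain
    embeddings, [rv_related] for those that preserve leading terms. *)
Definition is_graph (P : M -> M -> Prop) g : Prop :=
  is_subgraph g /\ forall x y, g (x, y) -> P x y.

Section GraphRing.
Variables (g : set (M * M)) (sg : is_subgraph g).

Lemma gr_B u w : g u -> g w -> g (u - w). Proof. by case: sg => _ _ + _; apply. Qed.
Lemma gr_M u w : g u -> g w -> g (u * w). Proof. by case: sg => _ _ _; apply. Qed.
Lemma gr_K c : K c -> g (c, c). Proof. by case: sg => _ + _ _; apply. Qed.
Lemma gr_1 : g (1, 1). Proof. by case: sg. Qed.
Lemma gr_0 : g (0, 0).
Proof. by have := gr_B gr_1 gr_1; rewrite subrr. Qed.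

Definition gr_pred (_ : is_subgraph g) : {pred M * M} := fun u => `[< g u >].
Local Notation S := (gr_pred sg).
Lemma gr_pred_subring : subring_closed S.
Proof.
split=> [|x y /asboolP gx /asboolP gy|x y /asboolP gx /asboolP gy];
  apply/asboolP; [exact: gr_1|exact: gr_B|exact: gr_M].
Qed.
HB.instance Definition _ := GRing.isSubringClosed.Build (M * M)%type S gr_pred_subring.

Record gr_type := GrType { gr_val :> M * M; gr_valP : gr_val \in S }.
HB.instance Definition _ := [isSub for gr_val].
HB.instance Definition _ := [Choice of gr_type by <:].
HB.instance Definition _ := [SubChoice_isSubComNzRing of gr_type by <:].

Definition gr_fst (u : gr_type) : M := (gr_val u).1.
Definition gr_snd (u : gr_type) : M := (gr_val u).2.

Lemma gr_fst_is_zmod_morphism : zmod_morphism gr_fst.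
Proof. by move=> x y. Qed.
Lemma gr_fst_is_monoid_morphism : monoid_morphism gr_fst.
Proof. by split. Qed.
HB.instance Definition _ :=
  GRing.isZmodMorphism.Build gr_type M gr_fst gr_fst_is_zmod_morphism.
HB.instance Definition _ :=
  GRing.isMonoidMorphism.Build gr_type M gr_fst gr_fst_is_monoid_morphism.
Lemma gr_snd_is_zmod_morphism : zmod_morphism gr_snd.
Proof. by move=> x y. Qed.
Lemma gr_snd_is_monoid_morphism : monoid_morphism gr_snd.
Proof. by split. Qed.
HB.instance Definition _ :=
  GRing.isZmodMorphism.Build gr_type M gr_snd gr_snd_is_zmod_morphism.
HB.instance Definition _ :=
  GRing.isMonoidMorphism.Build gr_type M gr_snd gr_snd_is_monoid_morphism.

Definition gr_in x y (gxy : g (x, y)) : gr_type := GrType (asboolT gxy : (x, y) \in S).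

Lemma gr_in_val (u : gr_type) : g (gr_fst u, gr_snd u).
Proof. by rewrite -surjective_pairing; apply/asboolP; exact: (valP u). Qed.

Lemma gr_eqP (u w : gr_type) : gr_fst u = gr_fst w -> gr_snd u = gr_snd w -> u = w.
Proof.
move=> e1 e2; apply: val_inj => /=.
by rewrite [gr_val u]surjective_pairing [gr_val w]surjective_pairing; congr pair.
Qed.

Local Notation "p ^1" := (map_poly gr_fst p) (at level 2, format "p ^1").
Local Notation "p ^2" := (map_poly gr_snd p) (at level 2, format "p ^2").

Lemma gr_D u w : g u -> g w -> g (u + w).
Proof.
move=> gu gw; have := gr_B gu (gr_B gr_0 gw).
by rewrite -[(0, 0)]/(0 : M * M) sub0r opprK.
Qed.

Lemma gr_horner (q : {poly sf_type sfK}) x y : g (x, y) ->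
  g ((map_poly (@sf_val M K sfK) q).[x], (map_poly (@sf_val M K sfK) q).[y]).
Proof.
move=> gxy; elim/poly_ind: q => [|q c IH]; first by rewrite rmorph0 !horner0; apply: gr_0.
rewrite !rmorphD !rmorphM /= !map_polyX !map_polyC !hornerD !hornerM !hornerX !hornerC.
exact: (gr_D (gr_M IH gxy) (gr_K (sf_val_in c))).
Qed.

Section Extend.
Variables (P : M -> M -> Prop) (p : {poly gr_type}) (z z' : M).
Hypotheses (pm : p \is monic) (rz : root p^1 z) (rz' : root p^2 z').
Hypothesis (Pp : forall r : {poly gr_type}, (size r < size p)%N -> P r^1.[z] r^2.[z']).

(** Division by the monic [p] makes sense even if the graph ring has zero divisors. It reduces any
    polynomial to a remainder with the same values at [z] and [z'], so [P] has to be checked on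
    remainders only. *)
Lemma graph_extend : exists g', [/\ is_graph P g', g `<=` g' & g' (z, z')].
Proof.
exists [set u | exists q : {poly gr_type}, u = (q^1.[z], q^2.[z'])]; split.
- split; first split.
  + by exists 1; rewrite !rmorph1 !hornerC.
  + by move=> c Kc; exists (gr_in (gr_K Kc))%:P; rewrite !map_polyC !hornerC.
  + by move=> _ _ [q ->] [r ->]; exists (q - r); rewrite !rmorphB !hornerD !hornerN.
  + by move=> _ _ [q ->] [r ->]; exists (q * r); rewrite !rmorphM !hornerM.
  + move=> _ _ [q [-> ->]].
    have := Pdiv.RingMonic.rdivp_eq pm q => ->.
    rewrite !rmorphD !rmorphM !hornerD !hornerM (rootP rz) (rootP rz') !mulr0 !add0r.
    by apply: Pp; rewrite Pdiv.Ring.ltn_rmodp monic_neq0.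
- by move=> [x y] gxy; exists (gr_in gxy)%:P; rewrite !map_polyC !hornerC.
- by exists 'X; rewrite !map_polyX !hornerX.
Qed.
End Extend.

Section Functional.
Hypothesis functional : forall y, g (0, y) -> y = 0.

(** The inverse of the algebraic element [x] is a polynomial in [x] over [K], and graphs are closed
    under such polynomials. *)
Lemma gr_inv x y : x != 0 -> g (x, y) -> exists y', g (x^-1, y').
Proof.
move=> x0 gxy; have : adjoin K x x^-1.
  by move=> E sE _ Ex; apply: (sfV sE).
by move/(adjoinP sfK (alg x)) => [q ->]; exists (map_poly (@sf_val M K sfK) q).[y]; apply: gr_horner.
Qed.

Lemma gr_fst_eq0 (u : gr_type) : gr_fst u = 0 -> u = 0.
Proof.
move=> u0; apply: gr_eqP; rewrite rmorph0 //.
by apply: functional; rewrite -u0; apply: gr_in_val.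
Qed.

Lemma gr_fst_inj : injective gr_fst.
Proof.
move=> u w e; apply/eqP; rewrite -subr_eq0; apply/eqP/gr_fst_eq0.
by rewrite rmorphB /= e subrr.
Qed.

Lemma gr_monic (p : {poly gr_type}) : p != 0 ->
  exists2 c, gr_fst c = (gr_fst (lead_coef p))^-1 &
    (c *: p) \is monic /\ size (c *: p) = size p.
Proof.
move=> p0; have l0 : gr_fst (lead_coef p) != 0.
  by apply: contraNneq p0 => /gr_fst_eq0/eqP; rewrite lead_coef_eq0.
have [y gy] := gr_inv l0 (gr_in_val _).
exists (gr_in gy) => //.
have c1 : gr_in gy * lead_coef p = 1.
  by apply: gr_fst_inj; rewrite rmorphM rmorph1 /= mulVf.
have sz : size (gr_in gy *: p) = size p.
  apply/eqP; rewrite eqn_leq size_scale_leq /=.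
  rewrite -[size p]prednK ?size_poly_gt0 // ltnNge; apply/negP => h.
  have := oner_neq0 gr_type; rewrite -c1 /lead_coef -coefZ nth_default ?eqxx //.
by split=> //; rewrite monicE lead_coefE sz coefZ -lead_coefE c1.
Qed.
End Functional.

End GraphRing.

Lemma graph_maximal (P : M -> M -> Prop) g0 : is_graph P g0 ->
  exists g, [/\ is_graph P g, g0 `<=` g
    & forall g', is_graph P g' -> g `<=` g' -> g' `<=` g].
Proof.
move=> gg0.
(* Zorn's lemma is applied to the sets whose union with [g0] is a graph; the union of the empty
   chain has this property too. *)
have [|A [gA mA]] := @Zorn_bigcup _ [set A | is_graph P (A `|` g0)].
  move=> F FQ Ftot.
  have common u w : (\bigcup_(X in F) X `|` g0) u -> (\bigcup_(X in F) X `|` g0) w ->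
      exists X, [/\ is_graph P (X `|` g0), (X `|` g0) u, (X `|` g0) w &
        X `|` g0 `<=` \bigcup_(X in F) X `|` g0].
    have sub X : F X -> X `|` g0 `<=` \bigcup_(X in F) X `|` g0.
      by move=> FX t [Xt|]; [left; exists X|right].
    move=> [[X FX Xu]|g0u]; move=> [[Y FY Yw]|g0w].
    - have [XY|YX] := Ftot _ _ FX FY.
        by exists Y; split; [exact: FQ|left; exact: XY|left|exact: sub].
      by exists X; split; [exact: FQ|left|left; exact: YX|exact: sub].
    - by exists X; split; [exact: FQ|left|right|exact: sub].
    - by exists Y; split; [exact: FQ|right|left|exact: sub].
    - by exists set0; split; [rewrite set0U|right|right|by move=> t [//|g0t]; right].
  split; first split.
  - by right; case: gg0 => -[].
  - by move=> c Kc; right; case: gg0 => -[_ + _ _] _; apply.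
  - move=> u w /common cu /cu [X [[[_ _ gB _] _] Xu Xw]]; apply; exact: gB.
  - move=> u w /common cu /cu [X [[[_ _ _ gM] _] Xu Xw]]; apply; exact: gM.
  - by move=> x y xy; have [X [[_ gP] Xu _ _]] := common _ _ xy xy; apply: gP.
exists (A `|` g0); split=> // g' gg' sg' u g'u.
apply: contrapT => nu; apply: (mA g').
  split; first by move=> x Ax; apply: sg'; left.
  by move=> /(_ u g'u) Au; apply: nu; left.
by rewrite /= (_ : g' `|` g0 = g') //; apply/setUidPl => x gx; apply: sg'; right.
Qed.

End Graphs.

Lemma poly_roots (M : closedFieldType) (q : {poly M}) : q != 0 ->
  exists2 rs : seq M, uniq rs & forall x, (x \in rs) = root q x.
Proof.
move=> q0; have [r qr] := closed_field_poly_normal q.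
exists (undup r); first exact: undup_uniq.
move=> x; rewrite mem_undup qr rootZ ?lead_coef_eq0 //.
by rewrite root_prod_XsubC.
Qed.

(** * Extension of embeddings to automorphisms *)

Section Automorphisms.
Variables (M : closedFieldType) (K : set M) (sfK : is_subfield K).
Hypothesis alg : forall x, is_algebraic K x.

(** For a graph, which is closed under differences, this condition means being single-valued. *)
Definition functional_at (x y : M) := x = 0 -> y = 0.

Lemma algebraic_extend (E : set M) x : K `<=` E -> is_algebraic E x.
Proof. by move=> KE; have [p [pK p0 rp]] := alg x; exists p; split=> // i; apply: KE. Qed.

Lemma alg_poly x : exists2 q : {poly sf_type sfK}, q != 0 & root (map_poly (@sf_val M K sfK) q) x.
Proof.
have [_ [/(poly_overP sfK) [q ->] q0 rq]] := alg x; exists q => //.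
by rewrite map_poly_eq0 in q0.
Qed.

Lemma gr_poly_lift g (sg : is_subgraph K g) (q : {poly sf_type sfK}) :
  exists2 p : {poly gr_type sg}, map_poly (@gr_fst _ _ _ sg) p = map_poly (@sf_val M K sfK) q &
    map_poly (@gr_snd _ _ _ sg) p = map_poly (@sf_val M K sfK) q.
Proof.
pose f (c : sf_type sfK) : gr_type sg := gr_in sg (gr_K sg (sf_val_in c)).
have f0 : f 0 = 0 by apply: gr_eqP; exact: (rmorph0 (@sf_val M K sfK)).
by exists (map_poly f q); apply/polyP => i; rewrite !coef_map_id0 ?rmorph0.
Qed.

(** An endomorphism over [K] maps the finite root set of a polynomial over [K] injectively into
    itself, hence onto. Every element is such a root, which gives surjectivity. *)
Lemma field_automorphism_K (s : {rmorphism M -> M}) : (forall x, K x -> s x = x) ->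
  field_automorphism K s.
Proof.
move=> sK; split=> //.
have surj y : exists x, s x = y.
  have [q q0 ry] := alg_poly y.
  have [|rs urs rsP] := @poly_roots _ (map_poly (@sf_val M K sfK) q); first by rewrite map_poly_eq0.
  have sub : {subset map s rs <= rs}.
    move=> _ /mapP [x xr ->]; move: xr; rewrite !rsP => xr.
    rewrite (_ : map_poly _ q = map_poly s (map_poly (@sf_val M K sfK) q)); first by rewrite fmorph_root.
    by apply/polyP => i; rewrite !coef_map /= sK //; apply: sf_val_in.
  have us : uniq (map s rs) by rewrite map_inj_uniq //; apply: fmorph_inj.
  have [|_ e] := uniq_min_size us sub; first by rewrite size_map.
  by move: ry; rewrite -rsP -e => /mapP [x _ ->]; exists x.
have [t tP] := choice surj.
by exists t => x //; apply: (fmorph_inj s).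
Qed.

(** Over the domain of a maximal graph, take a monic polynomial of least degree vanishing at [z].
    Adjoining [z] together with a root of the image polynomial cannot enlarge the graph, so [z] was
    in the domain. *)
Lemma graph_total g0 : is_graph K functional_at g0 ->
  exists2 s : {rmorphism M -> M}, field_automorphism K s & forall x y, g0 (x, y) -> s x = y.
Proof.
move=> /graph_maximal [g [[sg gP] g0g gmax]].
have fn y : g (0, y) -> y = 0 by move=> /gP; apply.
have total z : exists y, g (z, y).
  have [q q0 rq] := alg_poly z.
  have [p0 p01 _] := gr_poly_lift sg q.
  pose Q n := `[< exists p : {poly gr_type sg},
     [/\ p != 0, root (map_poly (@gr_fst _ _ _ sg) p) z & size p = n] >].
  have exQ : exists n, Q n.
    exists (size p0); apply/asboolP; exists p0; rewrite p01; split=> //.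
    by apply: contraNneq q0 => p00; rewrite -(map_poly_eq0 (@sf_val M K sfK)) -p01 p00 rmorph0.
  case: (ex_minnP exQ) => _ /asboolP [p [pn0 rp <-]] mn.
  have [c c1 [pm szp]] := gr_monic sfK alg fn pn0.
  have c0 : gr_fst c != 0.
    rewrite c1 invr_eq0; apply: contraNneq pn0 => /(gr_fst_eq0 fn)/eqP.
    by rewrite lead_coef_eq0.
  have rz : root (map_poly (@gr_fst _ _ _ sg) (c *: p)) z.
    by rewrite map_polyZ rootZ.
  have [z' rz'] : exists z', root (map_poly (@gr_snd _ _ _ sg) (c *: p)) z'.
    apply/closed_rootP; rewrite size_map_poly_id0; last first.
      by rewrite (monicP pm) rmorph1 oner_neq0.
    apply/negP => /eqP sz1; move: rz; rewrite (size1_polyC (eq_leq sz1)).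
    have := monicP pm; rewrite lead_coefE sz1 /= => ->.
    by rewrite polyC1 rmorph1 (negPf (root1 _)).
  (* By minimality of the size of [p], a remainder that vanishes at [z] is zero. *)
  have [r szr|g' [gg' sg' gz]] := graph_extend (P := functional_at) pm rz rz'.
    move=> r0; have [->|rn0] := eqVneq r 0; first by rewrite rmorph0 horner0.
    have : (size p <= size r)%N.
      by apply: mn; apply/asboolP; exists r; split=> //; apply/rootP.
    by rewrite leqNgt -szp szr.
  by exists z'; apply: (gmax g').
have [s sP] := choice total.
have uq x y : g (x, y) -> s x = y.
  move=> gxy; apply/eqP; rewrite -subr_eq0; apply/eqP/fn.
  by have := gr_B sg (sP x) gxy; rewrite /= -[_ - _]/(x - x, s x - y) subrr.
have sB : zmod_morphism s by move=> x y; apply: uq; exact: (gr_B sg (sP x) (sP y)).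
have sM : monoid_morphism s.
  split=> [|x y]; apply: uq; [exact: (gr_1 sg)|exact: (gr_M sg (sP x) (sP y))].
pose s' : {rmorphism M -> M} := HB.pack s (GRing.isZmodMorphism.Build _ _ s sB)
  (GRing.isMonoidMorphism.Build _ _ s sM).
exists s'; first by apply: field_automorphism_K => x Kx; apply: uq; exact: (gr_K sg).
by move=> x y /g0g /uq.
Qed.

(** The pairs of values at [x] and [y] of polynomials over [E] form a graph. It is single-valued
    because a polynomial vanishing at [x] vanishes at its conjugate [y]. *)
Lemma conjugate_aut (E : set M) x y : is_subfield E -> K `<=` E -> conjugate E x y ->
  exists s : {rmorphism M -> M},
   [/\ field_automorphism K s, forall e, E e -> s e = e & s x = y].
Proof.
move=> sE KE cxy; have aE u : is_algebraic E u := algebraic_extend u KE.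
pose ev (q : {poly sf_type sE}) u := (map_poly (@sf_val M E sE) q).[u].
have [|s sa sP] := @graph_total [set u | exists q, u = (ev q x, ev q y)].
  split; first split.
  - by exists 1; rewrite /ev !rmorph1 !hornerC.
  - by move=> c /KE Ec; exists (sf_in sE Ec)%:P; rewrite /ev !map_polyC !hornerC.
  - by move=> _ _ [q ->] [r ->]; exists (q - r); rewrite /ev !rmorphB !hornerD !hornerN.
  - by move=> _ _ [q ->] [r ->]; exists (q * r); rewrite /ev !rmorphM !hornerM.
  - move=> _ _ [q [-> ->]] /rootP q0; apply/rootP; exact: (conjugate_root (aE x) q0).
exists s; split=> // [e Ee|]; apply: sP.
  by exists (sf_in sE Ee)%:P; rewrite /ev !map_polyC !hornerC.
by exists 'X; rewrite /ev !map_polyX !hornerX.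
Qed.

Lemma aut_conjugate x (s : {rmorphism M -> M}) : field_automorphism K s -> conjugate K x (s x).
Proof.
move=> [_ sK]; have [p [pE _ pP]] := minpoly_sfP sfK (alg x).
rewrite /conjugate pE.
rewrite (_ : map_poly _ p = map_poly s (map_poly (@sf_val M K sfK) p)).
  by rewrite fmorph_root pP.
by apply/polyP => i; rewrite !coef_map /= sK //; apply: sf_val_in.
Qed.

Lemma aut_inv (s : {rmorphism M -> M}) : field_automorphism K s ->
  exists t : {rmorphism M -> M}, [/\ field_automorphism K t, cancel s t & cancel t s].
Proof.
move=> [[t st ts] sK].
pose t' : {rmorphism M -> M} := HB.pack t
  (GRing.isZmodMorphism.Build _ _ t (can2_zmod_morphism st ts))
  (GRing.isMonoidMorphism.Build _ _ t (can2_monoid_morphism st ts)).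
exists t'; split=> //; apply: field_automorphism_K => x Kx.
by rewrite -{1}(sK x Kx) [LHS]st.
Qed.

Lemma aut_comp (s t : {rmorphism M -> M}) : field_automorphism K s -> field_automorphism K t ->
  field_automorphism K (s \o t : {rmorphism M -> M}).
Proof.
by move=> [_ sK] [_ tK]; apply: field_automorphism_K => x Kx /=; rewrite tK // sK.
Qed.

End Automorphisms.

(** * Valuations and leading terms *)

Section ValuationLemmas.
Variables (M : fieldType) (G : orderedGroupType) (v : valuation M G).
Implicit Types x y z : M.

Lemma v0 : v 0 = Infty. Proof. exact/val_eq_Infty. Qed.

Lemma v_ltInfty x : (v x < Infty) = (x != 0).
Proof.
apply/idP/idP; first by apply: contraTneq => ->; rewrite v0 ltxx.
by case E : (v x) => [g|] // /eqP []; apply/(val_eq_Infty v).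
Qed.

Lemma v_fin x : x != 0 -> exists g, v x = Fin g.
Proof. by rewrite -v_ltInfty; case: (v x) => // g _; exists g. Qed.

Lemma lt_neq0 x h : v x < h -> x != 0.
Proof. by move=> xh; rewrite -v_ltInfty; apply: (lt_le_trans xh); case: h {xh}. Qed.

Lemma withtop_le_add (g h k : withtop G) : g <= h -> g + k <= h + k.
Proof.
case: h => [h|]; last by case: g; case: k.
case: g => [g|] //; case: k => [k|] // gh.
exact: (og_leD2r k g h gh).
Qed.

Lemma v_le_mul z x y : v x <= v y -> v (z * x) <= v (z * y).
Proof. by rewrite !val_mul ![v z + _]addrC; apply: withtop_le_add. Qed.

Lemma v_le_mul2l z x y : z != 0 -> (v (z * x) <= v (z * y)) = (v x <= v y).
Proof.
move=> z0; apply/idP/idP; last exact: v_le_mul.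
by move/(v_le_mul z^-1); rewrite !mulKf.
Qed.

Lemma v_lt_mul2l z x y : z != 0 -> (v (z * x) < v (z * y)) = (v x < v y).
Proof. by move=> z0; rewrite !ltNge v_le_mul2l. Qed.

Lemma v_eq_mul z x y : v x = v y -> v (z * x) = v (z * y).
Proof. by rewrite !val_mul => ->. Qed.

Lemma v_le_div x y : x != 0 -> (v x <= v y) = (Fin 0 <= v (y / x)).
Proof. by move=> x0; rewrite -(Defs.val1 v) -(v_le_mul2l 1 (y / x) x0) mulr1 mulrC divfK. Qed.

Lemma v_add_le g x y : g <= v x -> g <= v y -> g <= v (x + y).
Proof. by move=> gx gy; apply: le_trans (val_add v _ _); rewrite le_min gx. Qed.

Lemma v_add_lt g x y : g < v x -> g < v y -> g < v (x + y).
Proof. by move=> gx gy; apply: lt_le_trans (val_add v _ _); rewrite lt_min gx. Qed.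

Lemma v_subC x y : v (x - y) = v (y - x).
Proof. by rewrite -valN opprB. Qed.

Lemma v_sub_le g x y : g <= v x -> g <= v y -> g <= v (x - y).
Proof. by move=> gx gy; apply: v_add_le; rewrite ?valN. Qed.

Lemma v_sub_lt g x y : g < v x -> g < v y -> g < v (x - y).
Proof. by move=> gx gy; apply: v_add_lt; rewrite ?valN. Qed.

Lemma v_sum_le (I : Type) (r : seq I) (P : pred I) (F : I -> M) g :
  (forall i, P i -> g <= v (F i)) -> g <= v (\sum_(i <- r | P i) F i).
Proof.
move=> gF; elim/big_rec: _ => [|i x Pi gx]; first by rewrite v0; case: g {gF}.
by apply: v_add_le => //; apply: gF.
Qed.

Lemma v_sum_lt (I : Type) (r : seq I) (P : pred I) (F : I -> M) g : g < Infty ->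
  (forall i, P i -> g < v (F i)) -> g < v (\sum_(i <- r | P i) F i).
Proof.
move=> gfin gF; elim/big_rec: _ => [|i x Pi gx]; first by rewrite v0.
by apply: v_add_lt => //; apply: gF.
Qed.

Lemma v_add_eq x y : v x < v y -> v (x + y) = v x.
Proof.
move=> xy; apply/le_anti/andP; split; last by rewrite v_add_le ?lexx ?ltW.
rewrite leNgt; apply/negP => h; have : v x < v ((x + y) - y) by apply: v_sub_lt.
by rewrite addrK ltxx.
Qed.

Lemma v_pow_eq x y n : v x = v y -> v (x ^+ n) = v (y ^+ n).
Proof. by move=> e; elim: n => // n IH; rewrite !exprS !val_mul e IH. Qed.

(* Equality of leading terms, i.e. in RV; it forces [x] to be nonzero. *)
Definition near x y := v x < v (y - x).

Lemma near_v x y : near x y -> v y = v x.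
Proof. by move=> xy; rewrite -(v_add_eq xy) subrKC. Qed.

Lemma near_neq0 x y : near x y -> x != 0. Proof. exact: lt_neq0. Qed.

Lemma nearxx x : x != 0 -> near x x.
Proof. by rewrite /near subrr v0 v_ltInfty. Qed.

Lemma near_sym x y : near x y -> near y x.
Proof. by move=> xy; rewrite /near (near_v xy) v_subC. Qed.

Lemma near_trans x y z : near x y -> near y z -> near x z.
Proof.
move=> xy yz; rewrite /near -[z - x](subrKA y); apply: v_add_lt => //.
by rewrite -(near_v xy).
Qed.

Lemma near_mul x y x' y' : near x y -> near x' y' -> near (x * x') (y * y').
Proof.
move=> xy xy'; rewrite /near.
rewrite (_ : y * y' - x * x' = y' * (y - x) + x * (y' - x')); last first.
  by rewrite mulrBr mulrBr [y' * y]mulrC [y' * x]mulrC addrA subrK.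
apply: v_add_lt; last by rewrite v_lt_mul2l // (near_neq0 xy).
rewrite mulrC (val_mul v x') -(near_v xy') -val_mul v_lt_mul2l //.
by rewrite (near_neq0 (near_sym xy')).
Qed.

Lemma near_pow x y n : near x y -> near (x ^+ n) (y ^+ n).
Proof.
move=> xy; elim: n => [|n IH]; first by rewrite !expr0; apply/nearxx/oner_neq0.
by rewrite !exprS; apply: near_mul.
Qed.


(** If no [z] is near [x], each factor has value at most [v x], and the product cannot exceed the
    power. *)
Lemma v_prod_lt (r : seq M) x : v (x ^+ size r) < v (\prod_(z <- r) (x - z)) ->
  exists2 z, z \in r & near x z.
Proof.
move=> h; have [/hasP [z zr xz]|/hasPn no] := boolP (has (fun z => v x < v (z - x)) r).
  by exists z.
suff : v (\prod_(z <- r) (x - z)) <= v (x ^+ size r) by rewrite leNgt h.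
elim: r no {h} => [|z r IH] no; first by rewrite big_nil.
rewrite big_cons exprS; apply: (@le_trans _ _ (v ((x - z) * x ^+ size r))).
  by apply/v_le_mul/IH => y yr; apply: no; rewrite inE yr orbT.
rewrite mulrC [x * _]mulrC; apply: v_le_mul.
by rewrite v_subC leNgt; apply: no; rewrite mem_head.
Qed.

Lemma min_term (q : {poly M}) x : q != 0 -> x != 0 ->
  exists i0, q`_i0 * x ^+ i0 != 0 /\ forall i, v (q`_i0 * x ^+ i0) <= v (q`_i * x ^+ i).
Proof.
move=> q0 x0; have sz : (0 < size q)%N by rewrite size_poly_gt0.
have lt : ((size q).-1 < size q)%N by rewrite prednK.
case: (@arg_minP _ _ _ (Ordinal lt) xpredT (fun i : 'I_(size q) => v (q`_i * x ^+ i)) isT).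
move=> i0 _ mi; have {}mi i : v (q`_i0 * x ^+ i0) <= v (q`_i * x ^+ i).
  case: (ltnP i (size q)) => h; first exact: (mi (Ordinal h)).
  by rewrite (nth_default 0 h) mul0r v0; case: (v _).
exists i0; split=> //; rewrite -v_ltInfty; apply: le_lt_trans (mi (size q).-1) _.
by rewrite v_ltInfty mulf_neq0 ?expf_neq0 // -lead_coefE lead_coef_eq0.
Qed.

(** Passing from [x] to a near point changes each nonzero term by something of larger value than the
    term itself. *)
Lemma v_poly_near (q : {poly M}) x y g : (forall i, g <= v (q`_i * x ^+ i)) -> g < Infty ->
  near x y -> g < v (q.[y] - q.[x]).
Proof.
move=> gq gfin xy; rewrite !horner_coef -sumrB; apply: v_sum_lt => // i _.
have [->|qi0] := eqVneq q`_i 0; first by rewrite !mul0r subrr v0.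
by rewrite -mulrBr; apply: (le_lt_trans (gq i)); rewrite v_lt_mul2l //; apply: near_pow.
Qed.

End ValuationLemmas.

(** * Extension of embeddings that preserve leading terms *)

Section RamificationExtension.
Variables (M : closedFieldType) (K : set M) (sfK : is_subfield K).
Hypothesis alg : forall x, is_algebraic K x.
Variables (G : orderedGroupType) (v : valuation M G).
Hypothesis hens : henselian v K.

Section Isometry.
Variables (s : {rmorphism M -> M}) (sa : field_automorphism K s).

Lemma comp_eq_Infty x : v (s x) = Infty <-> x = 0.
Proof.
rewrite (val_eq_Infty v); split=> [|->]; last exact: rmorph0.
by move/eqP; rewrite fmorph_eq0 => /eqP.
Qed.
Lemma comp_mul x y : v (s (x * y)) = v (s x) + v (s y).
Proof. by rewrite rmorphM val_mul. Qed.
Lemma comp_add x y : Order.min (v (s x)) (v (s y)) <= v (s (x + y)).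
Proof. by rewrite rmorphD val_add. Qed.
Definition comp_val : valuation M G := Valuation comp_eq_Infty comp_mul comp_add.

(** The valuation [comp_val] agrees with [v] on [K], so by henselianity both have the same valuation
    ring. *)
Lemma aut_ge0 x : (Fin 0 <= v (s x)) = (Fin 0 <= v x).
Proof. by apply: (hens (w := comp_val)) => y Ky /=; rewrite sa.2. Qed.

Lemma aut_le x y : (v (s x) <= v (s y)) = (v x <= v y).
Proof.
have [->|x0] := eqVneq x 0.
  by rewrite rmorph0 v0; apply/idP/idP => h; have : y = 0;
    try (by apply/(comp_eq_Infty y); case: (v (s y)) h);
    try (by apply/(val_eq_Infty v); case: (v y) h); move=> ->; rewrite ?rmorph0 v0.
by rewrite !v_le_div ?fmorph_eq0 // -fmorphV -rmorphM aut_ge0.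
Qed.

Lemma aut_lt x y : (v (s x) < v (s y)) = (v x < v y).
Proof. by rewrite !ltNge aut_le. Qed.

(* An automorphism permutes the finitely many conjugates of x monotonically with
   respect to v, so that v (s^i x) would otherwise be strictly monotone in i. *)
Lemma aut_isometry x : v (s x) = v x.
Proof.
have [q q0 rq] := alg_poly sfK alg x.
have [|rs _ rsP] := @poly_roots _ (map_poly (@sf_val M K sfK) q); first by rewrite map_poly_eq0.
pose f i := iter i s x.
have frs i : f i \in rs.
  rewrite rsP; elim: i => // i; rewrite /f /= => IH.
  rewrite (_ : map_poly _ q = map_poly s (map_poly (@sf_val M K sfK) q)); first by rewrite fmorph_root.
  by apply/polyP => j; rewrite !coef_map /= sa.2 //; apply: sf_val_in.
have noinj : ~ injective f.
  move=> fi; have := @uniq_leq_size _ (map f (iota 0 (size rs).+1)) rs.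
  rewrite map_inj_uniq // iota_uniq size_map size_iota => /(_ isT); rewrite ltnn.
  by move=> h; suff : false by []; apply: h => _ /mapP [i _ ->].
have [lt|gt|//] := ltgtP (v x) (v (s x)); case: noinj.
- have mono i : v (f i) < v (f i.+1) by elim: i => [//|i IH]; rewrite /f /= aut_lt.
  have {}mono := homo_ltn lt_trans mono.
  by move=> i j e; case: (ltngtP i j) => // /mono; rewrite e ltxx.
- have mono i : v (f i) > v (f i.+1) by elim: i => [//|i IH]; rewrite /f /= aut_lt.
  have {}mono := @homo_ltn _ (fun i => v (f i)) (fun x y => y < x) (fun y x z yx zy => lt_trans zy yx) mono.
  by move=> i j e; case: (ltngtP i j) => // /mono; rewrite e ltxx.
Qed.

End Isometry.

Lemma horner_map_coef (R S : nzRingType) (f : {rmorphism R -> S}) (r : {poly R}) y :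
  (map_poly f r).[y] = \sum_(i < size r) f r`_i * y ^+ i.
Proof.
rewrite (@horner_coef_wide _ (size r)); last exact: size_poly.
by apply: eq_bigr => i _; rewrite coef_map.
Qed.

(** The pair of zeros is allowed separately because [near] forces nonzero elements. *)
Definition rv_related x y := (x = 0 /\ y = 0) \/ near v x y.

Lemma rv_functional g : is_graph K rv_related g -> forall y, g (0, y) -> y = 0.
Proof. by move=> [_ gP] y /gP [[]|/near_neq0 /eqP]. Qed.

Section Dense.
Variables (g : set (M * M)) (gg : is_graph K rv_related g).
Let sg : is_subgraph K g := gg.1.
Local Notation "p ^1" := (map_poly (@gr_fst _ _ _ sg) p) (at level 2, format "p ^1").
Local Notation "p ^2" := (map_poly (@gr_snd _ _ _ sg) p) (at level 2, format "p ^2").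

Lemma gr_rel (c : gr_type sg) : rv_related (gr_fst c) (gr_snd c).
Proof. exact: (gg.2 _ _ (gr_in_val c)). Qed.

Lemma gr_map_eq0 (p : {poly gr_type sg}) : (p^1 == 0) = (p == 0).
Proof.
apply/eqP/eqP => [p0|->]; last by rewrite rmorph0.
apply/polyP => i; rewrite coef0; apply: (gr_fst_eq0 (rv_functional gg)).
by have := congr1 (fun q : {poly M} => q`_i) p0; rewrite coef_map coef0.
Qed.

(** The terms of least value cancel at [x]; this replaces being a root when only leading terms are
    visible. *)
Definition cancels (x : M) (p : {poly gr_type sg}) :=
  exists i0, (forall i, v (p^1`_i0 * x ^+ i0) <= v (p^1`_i * x ^+ i)) /\
    v (p^1`_i0 * x ^+ i0) < v p^1.[x].

(** A polynomial of least size among those satisfying [cancels], made monic. One exists, since a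
    polynomial over [K] vanishing at [x] qualifies. *)
Lemma cancelling_poly x : x != 0 -> exists p : {poly gr_type sg},
  [/\ p \is monic, forall i, v (x ^+ (size p).-1) <= v (p^1`_i * x ^+ i),
      v (x ^+ (size p).-1) < v p^1.[x] &
      forall q : {poly gr_type sg}, (size q < size p)%N -> ~ cancels x q].
Proof.
move=> x0; have [q q0 rq] := alg_poly sfK alg x.
have [p0 p01 _] := gr_poly_lift sg q.
pose Q n := `[< exists2 p, cancels x p & size p = n >].
have exQ : exists n, Q n.
  exists (size p0); apply/asboolP; exists p0 => //.
  have [|i0 [i00 mi]] := @min_term _ _ v (p0^1) x _ x0; first by rewrite p01 map_poly_eq0.
  by exists i0; split=> //; rewrite p01 (rootP rq) v0 v_ltInfty -p01.
case: (ex_minnP exQ) => _ /asboolP [p Qp <-] mn {q q0 rq p0 p01 exQ}.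
have {}mn (q : {poly gr_type sg}) : (size q < size p)%N -> ~ cancels x q.
  by move=> sq Qq; move: sq; rewrite ltnNge mn //; apply/asboolP; exists q.
have [i0 [mi0 lt0]] := Qp.
have pn0 : p != 0.
  by apply: contraTneq (lt_neq0 lt0) => ->; rewrite rmorph0 coef0 mul0r eqxx.
have szp : (size p).-1.+1 = size p by rewrite prednK // size_poly_gt0.
set N := (size p).-1 in szp *.
(* If the top term were not of least value, dropping it would preserve the cancellation and give a
   smaller polynomial. *)
have top : v (p^1`_N * x ^+ N) <= v (p^1`_i0 * x ^+ i0).
  rewrite leNgt; apply/negP => h.
  apply: (mn (\poly_(i < N) p`_i)); first by rewrite -szp ltnS size_poly.
  have co i : (\poly_(i < N) p`_i)^1`_i = if (i < N)%N then p^1`_i else 0.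
    by rewrite !coef_map coef_poly; case: ifP => //; rewrite rmorph0.
  have i0N : (i0 < N)%N.
    rewrite ltn_neqAle; apply/andP; split; first by apply: contraTneq h => ->; rewrite ltxx.
    rewrite -ltnS szp leqNgt; apply/negP => le; have := lt_neq0 lt0.
    by rewrite coef_map nth_default // raddf0 mul0r eqxx.
  exists i0; split=> [i|]; rewrite !co i0N.
    by case: ifP => // _; rewrite mul0r v0; case: (v _).
  rewrite (@horner_coef_wide _ N); last first.
    by apply/leq_sizeP => j jN; rewrite co ltnNge jN.
  rewrite (eq_bigr (fun i : 'I_N => p^1`_i * x ^+ i)) => [|i _]; last by rewrite co ltn_ord.
  have := @horner_coef_wide _ N.+1 (p^1) x; rewrite big_ord_recr /= => e.
  have {}e := e _; rewrite (_ : \sum_(i < N) _ = p^1.[x] - p^1`_N * x ^+ N); last first.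
    rewrite e ?addrK //; by apply/leq_sizeP => j jN; rewrite coef_map nth_default ?raddf0 // -szp.
  exact: v_sub_lt.
have [c c1 [cm szc]] := gr_monic sfK alg (rv_functional gg) pn0.
have c0 : gr_fst c != 0.
  by rewrite c1 invr_eq0; apply: contraNneq pn0 => /(gr_fst_eq0 (rv_functional gg))/eqP; rewrite lead_coef_eq0.
have lc : gr_fst c * p^1`_N = 1.
  rewrite c1 coef_map -lead_coefE mulVf // -[X in X != 0]invrK -c1 invr_eq0 //.
exists (c *: p); rewrite szc -/N; split=> // [i|].
- rewrite map_polyZ coefZ -[x ^+ N]mul1r -lc -!mulrA v_le_mul2l //.
  exact: le_trans (mi0 i).
- rewrite map_polyZ hornerZ -[x ^+ N]mul1r -lc -!mulrA v_lt_mul2l //.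
  exact: le_lt_trans lt0.
Qed.

(** The product of the differences between [x] and the roots exceeds [v (x ^+ N)], so one root is
    near [x]. *)
Lemma monic_near_root (q : {poly M}) x N : q \is monic -> size q = N.+1 ->
  v (x ^+ N) < v q.[x] -> exists2 z, root q z & near v x z.
Proof.
move=> qm sq; have [r] := closed_field_poly_normal q; rewrite (monicP qm) scale1r => qr.
have szr : size r = N by apply: succn_inj; rewrite -sq qr size_prod_XsubC.
rewrite {1}qr horner_prod -szr; under eq_bigr do rewrite hornerXsubC.
by move=> /v_prod_lt [z zr xz]; exists z => //; rewrite qr root_prod_XsubC.
Qed.

(** The polynomial [p] has a root [z] near [x], and its image has a root [z'] near [z]. Adjoining
    the pair keeps leading terms, so by maximality it already belongs to the graph. *)
Lemma graph_dense : (forall g', is_graph K rv_related g' -> g `<=` g' -> g' `<=` g) ->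
  forall x, x != 0 -> exists z z', g (z, z') /\ near v x z.
Proof.
move=> gmax x x0; have [p [pm pc px mn]] := cancelling_poly x0.
have szp : size p = (size p).-1.+1 by rewrite prednK // size_poly_gt0 monic_neq0.
set N := (size p).-1 in pc px szp.
have xNfin : v (x ^+ N) < Infty by rewrite v_ltInfty expf_neq0.
have sz1 : size p^1 = N.+1 by rewrite size_map_poly_id0 // (monicP pm) rmorph1 oner_neq0.
have sz2 : size p^2 = N.+1 by rewrite size_map_poly_id0 // (monicP pm) rmorph1 oner_neq0.
have [z rz xz] := monic_near_root (monic_map _ pm) sz1 px.
have z0 := near_neq0 (near_sym xz).
have vz c i : v (c * z ^+ i) = v (c * x ^+ i).
  by apply/v_eq_mul/v_pow_eq/near_v.
(* Below the size of [p] no cancellation occurs at [x], hence none at the near point [z]: the value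
   at [z] is at most that of each term. *)
have rem (r : {poly gr_type sg}) : (size r < size p)%N ->
    forall i, v r^1.[z] <= v (r^1`_i * z ^+ i).
  move=> sr i; have [->|rn0] := eqVneq r 0; first by rewrite rmorph0 horner0 coef0 mul0r.
  have [|i0 [i00 mi]] := @min_term _ _ v (r^1) z _ z0; first by rewrite gr_map_eq0.
  apply: le_trans (mi i); rewrite leNgt; apply/negP => h.
  apply: (mn _ sr); exists i0; split=> [j|]; rewrite -!vz //.
  rewrite -[r^1.[x]](subrK r^1.[z]); apply: v_add_lt => //.
  by apply: v_poly_near => //; [rewrite v_ltInfty|apply: near_sym].
have relmul (c : gr_type sg) y y' : near v y y' ->
    gr_fst c = 0 /\ gr_snd c = 0 \/ near v (gr_fst c * y) (gr_snd c * y').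
  by move=> yy'; case: (gr_rel c) => [|h]; [left|right; apply: near_mul].
(* Corresponding coefficients have equal leading terms, so the image polynomial at [z] differs from
   the value 0 of [p] there by more than [v (z ^+ N)]. *)
have [z' rz' zz'] : exists2 z', root p^2 z' & near v z z'.
  apply: (monic_near_root (monic_map _ pm) sz2).
  rewrite -[p^2.[z]]subr0 -(rootP rz).
  rewrite (v_pow_eq _ (near_v xz)) !horner_coef sz1 sz2 -sumrB.
  apply: v_sum_lt => // i _; rewrite !coef_map.
  have [[/= -> ->]|] := relmul p`_i _ _ (nearxx v (expf_neq0 i z0)).
    by rewrite !mul0r subr0 v0.
  by move=> h; apply: le_lt_trans h; have := pc i; rewrite -vz coef_map.
have [r sr|g' [gg' sg' gz]] := graph_extend (P := rv_related) pm rz rz'; last first.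
  by exists z, z'; split=> //; apply: (gmax g').
have [->|rn0] := eqVneq r 0; first by left; rewrite !rmorph0 !horner0.
have r1 := rem r sr; right.
have r1z : r^1.[z] != 0.
  apply/eqP => e; have [|i0 [i00 _]] := @min_term _ _ v (r^1) z _ z0; first by rewrite gr_map_eq0.
  by have := r1 i0; rewrite e v0 leNgt v_ltInfty i00.
(* Each nonzero term changes by more than its own value, which is at least the value of the whole
   sum because nothing cancels at [z]. *)
rewrite /near [X in _ < v (X - _)]horner_map_coef [X in _ < v (_ - X)]horner_map_coef -sumrB.
apply: v_sum_lt => [|i _]; first by rewrite v_ltInfty.
have [[/= -> ->]|h] := relmul r`_i _ _ (near_pow i zz').
  by rewrite !mul0r subr0 v0 v_ltInfty.
by apply: le_lt_trans h; have := r1 i; rewrite coef_map.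
Qed.
End Dense.

(** A maximal graph extends to an automorphism [t]. Any [x] is near some [z] of the domain, [z] is
    near [t z], and [t z] is near [t x] because [t] is an isometry. *)
Theorem ramification_extend g0 : is_graph K rv_related g0 ->
  exists t : {rmorphism M -> M}, [/\ field_automorphism K t,
    forall x, x != 0 -> near v x (t x) & forall x y, g0 (x, y) -> t x = y].
Proof.
move=> /graph_maximal [g [gg g0g gmax]].
have [|t ta tP] := @graph_total _ _ sfK alg g.
  by split; [exact: gg.1|move=> x y /gg.2 [[_ -> //]|/near_neq0/eqP x0 /x0]].
exists t; split=> // [x x0|x y /g0g /tP //].
have [z [z' [gz xz]]] := graph_dense gg gmax x0.
apply: (near_trans xz); apply: near_trans (_ : near v (t z) _).
  by rewrite (tP _ _ gz); case: (gg.2 _ _ gz) => // -[z0]; move: (near_neq0 (near_sym xz)); rewrite z0 eqxx.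
by apply: near_sym; rewrite /near -rmorphB !aut_isometry.
Qed.

End RamificationExtension.

(** * Distances between conjugates *)

Section Distances.
Variables (M : closedFieldType) (K : set M) (sfK : is_subfield K).
Hypothesis alg : forall x, is_algebraic K x.
Variables (G : orderedGroupType) (v : valuation M G).
Hypothesis hens : henselian v K.
Local Notation "p ^v" := (map_poly (@sf_val M K sfK) p) (at level 2, format "p ^v").

(* Unlike in the ramification group, near-triviality is not restricted to the
   separable elements; this subgroup suffices and avoids separability of a - c. *)
Definition near_identity (t : {rmorphism M -> M}) : Prop :=
  field_automorphism K t /\ forall x, x != 0 -> near v x (t x).

Lemma near_identity_ramification t : near_identity t -> in_ramification_group v K t.
Proof. by move=> [ta tn]; split=> // x _; apply: tn. Qed.

(** The restriction of [s] to [E] extends to a [near_identity] automorphism, which agrees with [s]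
    at [x] and fixes [x]. *)
Lemma ramification_trivial (E : set M) (s : {rmorphism M -> M}) : is_subfield E -> K `<=` E ->
  field_automorphism K s -> (forall x, E x -> x != 0 -> near v x (s x)) ->
  forall x, E x -> (forall t, near_identity t -> t x = x) -> s x = x.
Proof.
move=> sE KE sa near_s x Ex xfix.
have [|t [ta tnear ts]] := @ramification_extend _ _ sfK alg _ v hens
    [set u | E u.1 /\ u.2 = s u.1].
  split; first split => /=.
  - by split; [exact: sf1|rewrite rmorph1].
  - by move=> c Kc; split; [exact: KE|rewrite sa.2].
  - by move=> [u u'] [w w'] /= [Eu ->] [Ew ->]; split; [exact: sfB|rewrite rmorphB].
  - by move=> [u u'] [w w'] /= [Eu ->] [Ew ->]; split; [exact: sfM|rewrite rmorphM].
  - move=> u _ /= [Eu ->]; have [->|u0] := eqVneq u 0; first by left; rewrite rmorph0.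
    by right; apply: near_s.
by rewrite -(ts x (s x)) //; apply: xfix.
Qed.

Lemma pchar_expf_inj (R : fieldType) n : [pchar R].-nat n -> injective (fun x : R => x ^+ n).
Proof.
move=> n_p x y /= xy; apply/eqP; rewrite -subr_eq0.
have : (x - y) ^+ n == 0 by rewrite exprDn_pchar // exprNn_pchar // xy subrr.
by rewrite expf_eq0 => /andP [].
Qed.

(** Write [N = q * m] with [q] the part of [N] at the characteristic, so [q = 1] in characteristic
    0. The power is the [m]-th power of ['X^q - (z ^+ q)%:P], and the coefficient is the one in
    degree [m.-1 * q]. *)
Lemma XsubC_exp_coef (R : fieldType) (z : R) N : (0 < N)%N ->
  exists q m, [/\ [pchar R].-nat q, m%:R != 0 :> R &
    exists i, (('X - z%:P) ^+ N)`_i = - (z ^+ q *+ m)].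
Proof.
move=> N0; exists (N`_[pchar R])%N, (N`_([pchar R])^')%N.
set q := (N`_[pchar R])%N; set m := (N`_([pchar R])^')%N.
have m0 : m%:R != 0 :> R by rewrite natf_neq0_pchar part_pnat.
split=> //; first by rewrite part_pnat.
have q0 : (0 < q)%N by rewrite part_gt0.
have qp : [pchar {poly R}].-nat q by rewrite (eq_pnat _ (pchar_poly R)) part_pnat.
exists (m.-1 * q)%N; rewrite -(partnC [pchar R] N0) exprM exprDn_pchar // exprNn_pchar //.
rewrite -/q -/m -polyC_exp; set c := z ^+ q.
rewrite (_ : _ ^+ m = (('X - c%:P) ^+ m) \Po 'X^q); last first.
  by rewrite [RHS](rmorphXn (comp_poly 'X^q)) /= comp_polyB comp_polyX comp_polyC.
rewrite coef_comp_poly_Xn // dvdn_mull // mulnK //.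
have -> : ('X - c%:P) ^+ m = \prod_(x <- nseq m c) ('X - x%:P).
  by rewrite big_nseq iter_mulr_1.
rewrite -{2}(size_nseq m c) coefPn_prod_XsubC ?size_nseq; last by apply: contraNneq m0 => ->.
by rewrite big_nseq iter_addr_0.
Qed.

(* All roots of the minimal polynomial of z over E equal z, so it is (X - z)^N. *)
Lemma fixed_power (E : set M) z : is_subfield E -> K `<=` E ->
  (forall s : {rmorphism M -> M}, field_automorphism K s -> (forall x, E x -> s x = x) -> s z = z) ->
  exists2 q, [pchar M].-nat q & E (z ^+ q).
Proof.
move=> sE KE zfix; have aE := algebraic_extend alg z KE.
have [p [pE pm pP]] := minpoly_sfP sE aE.
pose p' := map_poly (@sf_val M E sE) p.
have p'm : p' \is monic by rewrite map_monic.
have [r] := closed_field_poly_normal p'; rewrite (monicP p'm) scale1r => p'r.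
have rz : r = nseq (size r) z.
  apply/all_pred1P/allP => y yr /=.
  have cy : conjugate E z y by rewrite /conjugate pE -/p' p'r root_prod_XsubC.
  by have [s [sa sE' <-]] := conjugate_aut sfK alg sE KE cy; rewrite zfix.
set N := size r in rz.
have N0 : (0 < N)%N.
  rewrite lt0n; apply/eqP => N0; have := minpoly_size_gt1 sE aE.
  by rewrite pE -/p' p'r size_prod_XsubC -/N N0.
have {}p'r : p' = ('X - z%:P) ^+ N by rewrite p'r rz big_nseq iter_mulr_1.
have [q [m [qp m0 [i ci]]]] := XsubC_exp_coef z N0.
exists q => //; rewrite -p'r coef_map /= in ci.
have -> : z ^+ q = - sf_val p`_i / m%:R by rewrite ci opprK -mulr_natr mulfK.
apply: sf_div => //; first by apply: sfN => //; apply: sf_val_in.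
by elim: m {m0 ci} => [|m IH]; [apply: sf0|rewrite mulrS; apply: sfD => //; apply: sf1].
Qed.

Lemma aut_horner (s : {rmorphism M -> M}) (q : {poly sf_type sfK}) x : field_automorphism K s ->
  s q^v.[x] = q^v.[s x].
Proof.
move=> sa; rewrite -horner_map; congr (_.[_]).
by apply/polyP => i; rewrite !coef_map /= sa.2 //; apply: sf_val_in.
Qed.

Lemma adjoin_small a x : adjoin K a x ->
  exists2 q : {poly sf_type sfK}, (size q < size (minpoly K a))%N & x = q^v.[a].
Proof.
have [p [-> pm pP]] := minpoly_sfP sfK (alg a).
move=> /(adjoinP sfK (alg a)) [q ->]; exists (q %% p).
  by rewrite size_map_poly ltn_modp monic_neq0.
have /rootP ra : root p^v a by rewrite pP.
by rewrite {1}(divp_eq q p) rmorphD rmorphM hornerD hornerM ra mulr0 add0r.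
Qed.

(** In an Okutsu sequence of length 1, the elements of the last set have degree 1, so they lie in
    [K], and OS2 covers all degrees below that of [a]. *)
Lemma pure_approx a z : pure v K a -> (elt_degree K z < elt_degree K a)%N ->
  exists2 c, K c & v (a - z) <= v (a - c).
Proof.
move=> pu lt; have [A [d os]] : exists A d, okutsu_sequence v K a 1 A d.
  (* The default depth 0 is excluded because the depth is 1. *)
  move: pu; rewrite /pure /depth; case: xgetP => [n _ ex e|//].
  by rewrite e in ex.
have [d0 _ d1] := okutsu_OS1 os.
have [|y Ay le] := okutsu_OS2 os (i := 0%N) (z := z) isT; first by rewrite d0.
exists y => //; apply: (elt_degree1 sfK (alg y)).
by rewrite (okutsu_degree os (leqnn 1) Ay).
Qed.

(** Let [z] be a root of [q], where [x] is the value of [q] at [a]. Its degree is below that of [a],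
    so some [e] in [K] satisfies [v (a - z) <= v (a - e) < v (s a - a)], and [s a - z] is near
    [a - z]. Multiply over all roots. *)
Lemma pure_trivial a (s : {rmorphism M -> M}) : pure v K a -> field_automorphism K s ->
  (forall c, K c -> v (a - c) < v (s a - a)) ->
  forall x, adjoin K a x -> x != 0 -> near v x (s x).
Proof.
move=> pu sa far x /adjoin_small [q sq ->] q0; rewrite aut_horner //.
have qn0 : q != 0 by apply: contraNneq q0 => ->; rewrite rmorph0 horner0.
have [r] := closed_field_poly_normal q^v; set c := lead_coef _ => qr.
have c0 : c != 0 by rewrite lead_coef_eq0 map_poly_eq0.
rewrite qr !hornerZ; apply: near_mul; first exact: nearxx.
rewrite !horner_prod big_seq_cond [X in near _ _ X]big_seq_cond.
elim/big_rec2: _ => [|z y1 y2 /andP [zr _] near12]; first exact/nearxx/oner_neq0.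
rewrite !hornerXsubC; apply: near_mul => //.
rewrite /near opprB addrA subrK.
have [|e Ke le] := @pure_approx a z pu; last exact: le_lt_trans le (far e Ke).
apply: (@leq_ltn_trans (size q).-1).
  apply: (elt_degree_le (alg z) qn0).
  by rewrite qr rootZ // root_prod_XsubC.
rewrite (elt_degreeE sfK (alg a)) ltn_predRL prednK // size_poly_gt0 //.
Qed.

Section Minimality.
Variables (a : M) (L : set M).
Hypothesis La : L `<=` adjoin K a.
Hypothesis minL : minimal_extension L (adjoin K a).
Variable t : {rmorphism M -> M}.
Hypothesis ta : field_automorphism K t.
Hypothesis tL : forall x, L x -> t x = x.
Hypothesis t_a : t a <> a.

(** The automorphisms over [L] that displace [a] no further than [t] does. *)
Definition close_aut (r : {rmorphism M -> M}) : Prop :=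
  [/\ field_automorphism K r, forall x, L x -> r x = x & v (t a - a) <= v (r a - a)].

Lemma close_aut_fix r : field_automorphism K r -> (forall x, adjoin K a x -> r x = x) ->
  close_aut r.
Proof.
move=> ra rfix; split=> // [x /La /rfix //|]; rewrite rfix; last exact: mem_adjoin.
by rewrite subrr v0; case: (v _).
Qed.

(** Since [r] is an isometry, [r (s a) - r a] has the value of [s a - a]; the ultrametric inequality
    does the rest. *)
Lemma close_aut_comp r s : close_aut r -> close_aut s -> close_aut (r \o s).
Proof.
move=> [ra rL rd] [sa sL sd]; split; first exact: aut_comp.
  by move=> x Lx /=; rewrite sL // rL.
rewrite /= -[r (s a) - a](subrKA (r a)); apply: v_add_le => //.
by rewrite -rmorphB (aut_isometry sfK alg hens ra).
Qed.

(* The polynomial with roots the orbit of a under the close automorphisms has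
   coefficients of which some Frobenius power lies in N. If N = L, it is thus fixed
   by s, so that s a belongs to this orbit. *)
Lemma minimal_distance s : field_automorphism K s -> (forall x, L x -> s x = x) ->
  s a <> a -> v (t a - a) <= v (s a - a).
Proof.
move=> sa sL s_a.
(* By minimality this fixed field is [L] or the whole of [adjoin K a]; the latter is impossible
   because [t] is itself close and moves [a]. *)
pose N := [set x | adjoin K a x /\ forall r, close_aut r -> r x = x].
have sfN : is_subfield N.
  have sfA := adjoin_subfield K a.
  split=> [|x y [Ax Nx] [Ay Ny]|x y [Ax Nx] [Ay Ny]]; split.
  - exact: (sf1 sfA).
  - by move=> r _; rewrite rmorph1.
  - exact: (sfB sfA).
  - by move=> r rc; rewrite rmorphB Nx // Ny.
  - exact: (sf_div sfA).
  - by move=> r rc; rewrite fmorph_div Nx // Ny.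
have [||NL|NA] := minL sfN.
- by move=> x Lx; split; [apply: La|move=> r [_ rL _]; apply: rL].
- by move=> x [].
- have [p [pE pm pP]] := minpoly_sfP sfK (alg a).
  have p'm : p^v \is monic by rewrite map_monic.
  have [rs urs rsP] := poly_roots (monic_neq0 p'm).
  pose O := [seq b <- rs | `[< exists2 r, close_aut r & r a = b >]].
  have uO : uniq O by apply: filter_uniq.
  have OP b : reflect (exists2 r, close_aut r & r a = b) (b \in O).
    rewrite mem_filter; apply: (iffP andP) => [[/asboolP]//|h]; split; first exact/asboolP.
    have [r [ra _ _] <-] := h; rewrite rsP -pE.
    exact: (aut_conjugate sfK alg a ra).
  pose P := \prod_(b <- O) ('X - b%:P).
  have rP r : close_aut r -> map_poly r P = P.
    move=> rc; rewrite rmorph_prod /=.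
    rewrite (eq_bigr (fun b => 'X - (r b)%:P)) => [|b _]; last by rewrite rmorphB /= map_polyX map_polyC.
    rewrite -(big_map r xpredT (fun b => 'X - b%:P)); apply: perm_big.
    have ur : uniq (map r O) by rewrite map_inj_uniq //; apply: fmorph_inj.
    have sub : {subset map r O <= O}.
      move=> _ /mapP [_ /OP [r' rc' <-] ->]; apply/OP; exists (r \o r') => //.
      exact: close_aut_comp.
    have [|_ e] := uniq_min_size ur sub; first by rewrite size_map.
    exact: uniq_perm.
  have sP : map_poly s P = P.
    apply/polyP => i; rewrite coef_map /=.
    (* Automorphisms fixing [adjoin K a] pointwise are close, so they fix the coefficients of
       [P]. *)
    have [|r ra rfix|q qp Aq] := @fixed_power (adjoin K a) P`_i (adjoin_subfield K a).
    + exact: sub_adjoin.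
    + by have := congr1 (fun f : {poly M} => f`_i) (rP _ (close_aut_fix ra rfix)); rewrite coef_map.
    apply: (pchar_expf_inj qp); rewrite -rmorphXn sL //.
    rewrite -NL; split=> // r rc; rewrite rmorphXn.
    by have := congr1 (fun f : {poly M} => f`_i) (rP _ rc); rewrite coef_map => /= ->.
  have aO : a \in O.
    by apply/OP; exists idfun => //; apply: close_aut_fix => //; apply: field_automorphism_K.
  have : s a \in O.
    by rewrite -(root_prod_XsubC O) -/P -sP fmorph_root root_prod_XsubC.
  by move=> /OP [r [_ _ rd] <-].
- have : N a by rewrite NA; apply: mem_adjoin.
  by move=> [_ /(_ t)] /= h; case: t_a; apply: h; split.
Qed.

End Minimality.
End Distances.

(** * Valuation bases of tame extensions *)

Section Dedekind.
Variables (M k : fieldType) (S : set M) (S1 : S 1) (SM : forall x y, S x -> S y -> S (x * y)).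

(** Subtracting the relation at [x], multiplied by [chi ord_max y], from the relation at [y * x]
    eliminates the last character. Induction then kills the other coefficients. *)
Lemma dedekind_indep n (chi : 'I_n -> M -> k) (c : 'I_n -> k) :
  (forall j, chi j 1 = 1) -> (forall j x y, S x -> S y -> chi j (x * y) = chi j x * chi j y) ->
  (forall i j, i != j -> exists2 x, S x & chi i x != chi j x) ->
  (forall x, S x -> \sum_j c j * chi j x = 0) -> forall j, c j = 0.
Proof.
elim: n chi c => [|n IH] chi c chi1 chiM dist c0 j; first by case: j.
have w i : c (widen_ord (leqnSn n) i) = 0.
  have [|y Sy ney] := dist (widen_ord (leqnSn n) i) ord_max.
    by rewrite -val_eqE /= neq_ltn ltn_ord.
  have := IH (fun i => chi (widen_ord (leqnSn n) i))
    (fun i => c (widen_ord (leqnSn n) i) * (chi (widen_ord (leqnSn n) i) y - chi ord_max y)).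
  move=> /(_ (fun i => chi1 _) (fun i => chiM _)) h.
  suff /eqP : c (widen_ord (leqnSn n) i) * (chi (widen_ord (leqnSn n) i) y - chi ord_max y) = 0.
    by rewrite mulf_eq0 subr_eq0 (negPf ney) orbF => /eqP.
  move: i {ney}; apply: h => [i j' ij|]; first by apply: dist; rewrite -val_eqE.
  move=> x Sx; have := c0 _ (SM Sy Sx); have := congr1 ( *%R (chi ord_max y)) (c0 _ Sx).
  rewrite mulr0 !big_ord_recr /= !chiM // => e1 e2.
  have := congr2 (fun s t => s - t) e2 e1.
  rewrite subrr /= mulrDr opprD addrACA => e; rewrite -[RHS]e.
  rewrite [X in _ + X](_ : _ = 0) ?addr0; last by rewrite mulrCA subrr.
  rewrite mulr_sumr -sumrB; apply: eq_bigr => i _.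
  by rewrite chiM // mulrBr mulrBl -!mulrA; congr (_ - _); rewrite mulrCA.
case: (unliftP ord_max j) => [i ->|->].
  by rewrite -(w i); congr c; apply: val_inj; rewrite /= /bump leqNgt ltn_ord.
have := c0 _ S1; rewrite big_ord_recr /= big1 ?add0r => [|i _]; last by rewrite w mul0r.
by rewrite chi1 mulr1.
Qed.

(** Rows are added one by one. While there are fewer than [n], some nonzero column [c] is killed by
    all of them; independence of the characters yields an [x] whose row is not killed. *)
Lemma dedekind_det n (chi : 'I_n -> M -> k) :
  (forall j, chi j 1 = 1) -> (forall j x y, S x -> S y -> chi j (x * y) = chi j x * chi j y) ->
  (forall i j, i != j -> exists2 x, S x & chi i x != chi j x) ->
  exists x : 'I_n -> M, (forall i, S (x i)) /\ \det (\matrix_(i, j) chi j (x i)) != 0.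
Proof.
move=> chi1 chiM dist.
suff free r : (r <= n)%N -> exists A : 'M[k]_(r, n),
    row_free A /\ forall i, exists2 x, S x & forall j, A i j = chi j x.
  have [A [fA /(_ _)/cid2 Ax]] := free n (leqnn n).
  exists (fun i => projT1 (Ax i)); split=> [i|]; first by case: (Ax i).
  rewrite (_ : \matrix_(i, j) _ = A); last first.
    by apply/matrixP => i j; rewrite mxE; case: (Ax i).
  by move: fA; rewrite row_free_unit unitmxE unitfE.
elim: r => [|r IH] rn.
  by exists 0; split; [rewrite /row_free mxrank0|case].
have [A [fA Ax]] := IH (ltnW rn).
have [c Ac c0] : exists2 c : 'cV[k]_n, A *m c = 0 & c != 0.
  have : kermx A^T != 0.
    by rewrite kermx_eq0 /row_free mxrank_tr (eqP fA) neq_ltn rn.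
  case/rowV0Pn => u /sub_kermxP uA u0; exists u^T; last by rewrite -trmx0 (inj_eq trmx_inj).
  by apply: trmx_inj; rewrite trmx_mul trmxK uA trmx0.
have [x Sx cx] : exists2 x, S x & \sum_j c j 0 * chi j x != 0.
  apply: contrapT => no; case/eqP: c0; apply/colP => j; rewrite [RHS]mxE.
  apply: (dedekind_indep (chi := chi) (c := fun j => c j 0)) => // x Sx.
  by apply/eqP; apply: contrapT => h; apply: no; exists x => //; apply/negP.
pose w : 'rV[k]_n := \row_j chi j x.
have wc : w *m c = (\sum_j c j 0 * chi j x)%:M.
  by apply/matrixP => i j; rewrite !ord1 !mxE mulr1n; apply: eq_bigr => l _; rewrite !mxE mulrC.
rewrite -addn1; exists (col_mx A w); split; last first.
  move=> i; case: (splitP i) => j ij.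
    have [y Sy Ay] := Ax j; exists y => // l.
    by rewrite (_ : i = lshift 1 j) ?col_mxEu //; apply: val_inj.
  exists x => // l; rewrite (_ : i = rshift r j) ?col_mxEd ?mxE //; exact: val_inj.
rewrite -kermx_eq0; apply/eqP/row_matrixP => i; rewrite row0.
have : row i (kermx (col_mx A w)) *m col_mx A w = 0 by rewrite -row_mul mulmx_ker row0.
set u := row i _; rewrite -[u]hsubmxK; set ul := lsubmx u; set ur := rsubmx u.
rewrite mul_row_col => e.
(* Multiplication by [c] kills the old rows but not the new one. *)
have ur0 : ur = 0.
  have := congr1 (mulmx^~ c) e; rewrite /= mulmxDl -!mulmxA Ac mulmx0 add0r mul0mx wc.
  rewrite mul_mx_scalar => /eqP; rewrite scaler_eq0 (negPf cx) => /eqP //.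
have /eqP : ul *m A = 0 by rewrite -e ur0 mul0mx addr0.
by rewrite mulmx_free_eq0 // ur0 => /eqP ->; rewrite row_mx0.
Qed.

End Dedekind.

(** * The residue map *)

Section Residue.
Variables (M : fieldType) (G : orderedGroupType) (v : valuation M G).

HB.instance Definition _ := GRing.RMorphism.copy (@residue M G v)
  (\pi_(residue_field v)%qT : valuation_ring v -> residue_field v).

(** Extended by 0 outside the valuation ring, so that no proof of integrality has to be carried
    along. *)
Definition res (x : M) : residue_field v := residue (insubd (0 : valuation_ring v) x).

Lemma vr_ge0 (x : valuation_ring v) : Fin 0 <= v (vr_val x). Proof. exact: (vr_valP x). Qed.

Lemma res_val (x : valuation_ring v) : res (vr_val x) = residue x.
Proof. by rewrite /res valKd. Qed.

Lemma vr_lift x : Fin 0 <= v x -> exists2 y : valuation_ring v, vr_val y = x & res x = residue y.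
Proof. by move=> x0; exists (ValuationRing (x0 : x \in val_ring v)); rewrite // -res_val. Qed.

Lemma residue_eq0 (x : valuation_ring v) : (residue x == 0) = (Fin 0 < v (vr_val x)).
Proof.
rewrite /residue -(rmorph0 (\pi_(residue_field v)%qT)) -Quotient.idealrBE subr0.
by rewrite unfold_in.
Qed.

Lemma res_eq0 x : Fin 0 <= v x -> (res x == 0) = (Fin 0 < v x).
Proof. by move=> /vr_lift [y <- ->]; apply: residue_eq0. Qed.

Lemma res1 : res 1 = 1.
Proof. by rewrite (res_val 1) rmorph1. Qed.

Lemma resM x y : Fin 0 <= v x -> Fin 0 <= v y -> res (x * y) = res x * res y.
Proof.
by move=> /vr_lift [x' <- ->] /vr_lift [y' <- ->]; rewrite (res_val (x' * y')) rmorphM.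
Qed.

Lemma resD x y : Fin 0 <= v x -> Fin 0 <= v y -> res (x + y) = res x + res y.
Proof.
by move=> /vr_lift [x' <- ->] /vr_lift [y' <- ->]; rewrite (res_val (x' + y')) rmorphD.
Qed.

Lemma resB x y : Fin 0 <= v x -> Fin 0 <= v y -> res (x - y) = res x - res y.
Proof.
by move=> /vr_lift [x' <- ->] /vr_lift [y' <- ->]; rewrite (res_val (x' - y')) rmorphB.
Qed.

Lemma res_sum (I : Type) (r : seq I) (P : pred I) (F : I -> M) :
  (forall i, P i -> Fin 0 <= v (F i)) ->
  res (\sum_(i <- r | P i) F i) = \sum_(i <- r | P i) res (F i).
Proof.
move=> F0; elim: r => [|i r IH]; first by rewrite !big_nil (res_val 0) rmorph0.
rewrite !big_cons; case: ifP => // Pi; rewrite resD ?IH ?F0 //.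
exact: v_sum_le.
Qed.

Lemma vX_ge0 x n : Fin 0 <= v x -> Fin 0 <= v (x ^+ n).
Proof.
move=> x0; elim: n => [|n IH]; first by rewrite expr0 (Defs.val1 v).
by rewrite exprS val_mul withtop_addr_ge0.
Qed.

Lemma resX x n : Fin 0 <= v x -> res (x ^+ n) = res x ^+ n.
Proof.
move=> x0; elim: n => [|n IH]; first by rewrite !expr0 res1.
by rewrite !exprS resM ?IH // vX_ge0.
Qed.


Lemma residue_subfieldP (E : set M) (xi : residue_field v) : residue_subfield E xi <->
  exists x, [/\ E x, Fin 0 <= v x & res x = xi].
Proof.
split=> [[x Ex <-]|[x [Ex x0 <-]]]; first by exists (vr_val x); split; [|exact: vr_ge0|exact: res_val].
by have [y yx ->] := vr_lift x0; exists y => //=; rewrite yx.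
Qed.

Lemma resV x : v x = Fin 0 -> res x^-1 = (res x)^-1.
Proof.
move=> x0; have xn0 : x != 0 by rewrite -(v_ltInfty v) x0.
have v0 : v x^-1 = Fin 0.
  by have := val_mul v x x^-1; rewrite mulfV // (Defs.val1 v) x0 -[Fin 0]/(0 : withtop G) add0r.
have rx0 : res x != 0 by rewrite res_eq0 x0 ?ltxx.
by apply: (mulfI rx0); rewrite mulfV // -resM ?x0 ?v0 // mulfV // res1.
Qed.

Lemma residue_is_subfield E : is_subfield E -> is_subfield (residue_subfield (v := v) E).
Proof.
move=> sE; split.
- by apply/residue_subfieldP; exists 1; rewrite (Defs.val1 v) res1; split=> //; apply: sf1.
- move=> _ _ /residue_subfieldP [x [Ex x0 <-]] /residue_subfieldP [y [Ey y0 <-]].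
  by apply/residue_subfieldP; exists (x - y); rewrite resB // v_sub_le //; split=> //; apply: sfB.
- move=> _ _ /residue_subfieldP [x [Ex x0 <-]] /residue_subfieldP [y [Ey y0 <-]].
  apply/residue_subfieldP; have [ry|ry] := eqVneq (res y) 0.
    by exists 0; rewrite v0 (res_val 0) rmorph0 ry invr0 mulr0; split=> //; apply: sf0.
  have vy : v y = Fin 0.
    by move: ry; rewrite res_eq0 // -leNgt => ry; apply/le_anti; rewrite ry.
  have vy' : Fin 0 <= v y^-1.
    by rewrite -[y^-1]mul1r -v_le_div ?(Defs.val1 v) ?vy // -(v_ltInfty v) vy.
  exists (x / y); rewrite resM // resV //; split=> //; first exact: sf_div.
  by rewrite val_mul; apply: withtop_addr_ge0.
Qed.

End Residue.

(** * Valuation-independent families and their residues *)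

Section ValuationBases.
Variables (M : fieldType) (K : set M) (sfK : is_subfield K).
Variables (G : orderedGroupType) (v : valuation M G).
Local Notation kK := (residue_subfield (v := v) K).
Let sfk := residue_is_subfield v sfK.

(** By the ultrametric inequality, the value of a combination is then exactly the least value of its
    terms. *)
Definition val_indep n (x : 'I_n -> M) : Prop :=
  forall c : 'I_n -> M, (forall i, K (c i)) -> forall i, v (\sum_j c j * x j) <= v (c i * x i).

Lemma val_indep_indep n (x : 'I_n -> M) : (forall i, x i != 0) -> val_indep x -> lin_indep K x.
Proof.
move=> x0 vi c Kc c0 i; have := vi c Kc i; rewrite c0 v0 leNgt v_ltInfty mulf_eq0.
by rewrite (negPf (x0 i)) orbF negbK => /eqP.
Qed.

Lemma val_indep_scale n (x : 'I_n -> M) y : val_indep x -> val_indep (fun i => x i * y).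
Proof.
move=> vi c Kc i; under eq_bigr do rewrite mulrA.
by rewrite -mulr_suml mulrA mulrC [c i * _ * _]mulrC; apply: v_le_mul; apply: vi.
Qed.

Lemma spans_scale (E : set M) n (x : 'I_n -> M) y : is_subfield E -> E y -> y != 0 ->
  spans K E x -> spans K E (fun i => x i * y).
Proof.
move=> sE Ey y0 sp z Ez; have [c Kc zc] := sp _ (sf_div sE Ez Ey).
exists c => //; under eq_bigr do rewrite mulrA.
by rewrite -mulr_suml -zc divfK.
Qed.

(** A relation between residues lifts to a combination of positive value. Each of its terms then has
    positive value, so each residue coefficient is zero. *)
Lemma residue_indep n m (x : 'I_n -> M) (f : 'I_m -> 'I_n) (d : 'I_m -> M) :
  injective f -> (forall j, K (d j)) -> (forall j, d j != 0) -> (forall j, v (x (f j)) = v (d j)) ->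
  val_indep x -> lin_indep kK (fun j => res v (x (f j) / d j)).
Proof.
move=> fi Kd d0 xd vi e Ke e0 i.
have /choice [h hP] : forall j, exists y, [/\ K y, Fin 0 <= v y & res v y = e j].
  by move=> j; apply/residue_subfieldP.
have u0 j : v (x (f j) / d j) = Fin 0.
  by rewrite mulrC (v_eq_mul _ (xd j)) mulVf // (Defs.val1 v).
(* The fibres of [f] have at most one element: [c] is [h j / d j] at [f j] and 0 off the image of
   [f]. *)
pose c k := \sum_(j | f j == k) h j / d j.
have Kc k : K (c k).
  by apply: sf_sum => // j _; apply: sf_div => //; case: (hP j).
have cf j : c (f j) = h j / d j.
  rewrite /c (eq_bigl (pred1 j)) ?big_pred1_eq // => k.
  by rewrite (inj_eq fi).
have h0 j : Fin 0 <= v (h j * (x (f j) / d j)).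
  by rewrite val_mul u0 withtop_addr_ge0 //; case: (hP j).
have cE : \sum_k c k * x k = \sum_j h j * (x (f j) / d j).
  rewrite (partition_big f xpredT) //=; apply: eq_bigr => k _.
  by rewrite mulr_suml; apply: eq_bigr => j /eqP <-; rewrite mulrAC mulrA.
have pos : Fin 0 < v (\sum_k c k * x k).
  rewrite cE -res_eq0; last exact: v_sum_le.
  rewrite res_sum //; apply/eqP; rewrite -[RHS]e0; apply: eq_bigr => j _.
  by rewrite resM ?u0 //; case: (hP j) => // _ _ ->.
have := lt_le_trans pos (vi c Kc (f i)); rewrite cf.
have [_ hi0 <-] := hP i; move=> hp; apply/eqP; rewrite res_eq0 //.
by rewrite -mulrA [_^-1 * _]mulrC val_mul u0 -[Fin 0]/(0 : withtop G) addr0 in hp.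
Qed.

Definition in_value_group n (x : 'I_n -> M) : {set 'I_n} :=
  [set i | `[< exists2 c, K c & v c = v (x i) >]]%SET.

(** In the expansion of an integral element all terms are integral, and those at indices outside
    [in_value_group] have residue 0, so the remaining indices span. *)
Lemma residue_basis (E : set M) n (x : 'I_n -> M) : is_subfield E -> K `<=` E ->
  (forall i, E (x i)) -> (forall i, x i != 0) -> spans K E x -> val_indep x ->
  exists d : 'I_#|in_value_group x| -> M,
   [/\ forall j, K (d j), forall j, d j != 0,
       forall j, v (x (enum_val j)) = v (d j) &
       is_basis kK (residue_subfield E) (fun j => res v (x (enum_val j) / d j))].
Proof.
move=> sE KE Ex x0 sp vi.
have /choice [d dP] : forall j : 'I_#|in_value_group x|, exists c, K c /\ v c = v (x (enum_val j)).
  by move=> j; have := enum_valP j; rewrite inE => /asboolP [c Kc vc]; exists c.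
have Kd j : K (d j) by case: (dP j).
have vd j : v (x (enum_val j)) = v (d j) by case: (dP j).
have d0 j : d j != 0 by rewrite -(v_ltInfty v) -vd v_ltInfty.
exists d; split=> //.
have u0 j : v (x (enum_val j) / d j) = Fin 0.
  by rewrite mulrC (v_eq_mul _ (vd j)) mulVf // (Defs.val1 v).
apply/(is_basisP sfk); first exact: (sf0 (residue_is_subfield v sE)).
split=> [j||].
- apply/residue_subfieldP; exists (x (enum_val j) / d j); split=> //; last by rewrite u0.
  by apply: sf_div => //; apply: KE.
- exact: (residue_indep (@enum_val_inj _ _) Kd d0 vd vi).
- move=> xi /residue_subfieldP [z [Ez z0 <-]].
  have [c Kc zc] := sp _ Ez.
  have c0 i : Fin 0 <= v (c i * x i) by apply: le_trans z0 _; rewrite zc; apply: vi.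
  have cd j : c (enum_val j) * x (enum_val j) = (c (enum_val j) * d j) * (x (enum_val j) / d j).
    by rewrite mulrACA mulfV // mulr1.
  have cd0 j : Fin 0 <= v (c (enum_val j) * d j).
    by rewrite (v_eq_mul _ (esym (vd j))).
  exists (fun j => res v (c (enum_val j) * d j)).
    move=> j; apply/residue_subfieldP; exists (c (enum_val j) * d j); split=> //.
    exact: sfM.
  rewrite zc res_sum // (bigID [in in_value_group x]) /= [X in _ + X]big1 ?addr0; last first.
    (* A term of value 0 would give [x i] the value of the inverse of [c i], an element of [K]. *)
    move=> i; rewrite inE => /asboolPn no; apply/eqP; rewrite res_eq0 // lt_neqAle c0 andbT.
    apply/eqP => ci; apply: no; exists (c i)^-1; first exact: sfV.
    have ci0 : c i != 0.
      by apply: contra_eq_neq ci => ->; rewrite mul0r v0.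
    by rewrite -[x i](mulKf ci0) val_mul -ci -[Fin 0]/(0 : withtop G) addr0.
  rewrite big_enum_val; apply: eq_bigr => j _.
  by rewrite cd resM ?u0.
Qed.

End ValuationBases.

Section DetIndep.
Variables (M : closedFieldType) (K : set M) (sfK : is_subfield K).
Hypothesis alg : forall x, is_algebraic K x.
Variables (G : orderedGroupType) (v : valuation M G).
Hypothesis hens : henselian v K.

Lemma aut_ratio0 (s : {rmorphism M -> M}) x : field_automorphism K s -> x != 0 ->
  v (s x / x) = Fin 0.
Proof.
move=> sa x0.
by rewrite mulrC (v_eq_mul _ (aut_isometry sfK alg hens sa x)) mulVf // (Defs.val1 v).
Qed.

(* Multiplying (c_i x_i) by the matrix gives (s_j z), all of value v z, and the matrix
   is invertible over the valuation ring. *)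
Lemma det_val_indep n (s : 'I_n -> {rmorphism M -> M}) (x : 'I_n -> M) :
  (forall j, field_automorphism K (s j)) -> (forall i, x i != 0) ->
  \det (\matrix_(i, j) res v (s j (x i) / x i)) != 0 -> val_indep K v x.
Proof.
move=> sa x0 det0 c Kc i.
have r0 i' j : v (s j (x i') / x i') = Fin 0 by apply: aut_ratio0.
pose U : 'M[valuation_ring v]_n := \matrix_(i, j) insubd 0 (s j (x i) / x i).
have Uv i' j : vr_val (U i' j) = s j (x i') / x i'.
  rewrite mxE [LHS]insubdK //.
  by change (is_true (Fin 0 <= v (s j (x i') / x i'))); rewrite r0.
have dU : v (vr_val (\det U)) = Fin 0.
  apply/le_anti/andP; split; last exact: vr_ge0.
  rewrite leNgt -residue_eq0 -det_map_mx; apply: contraNneq det0 => <-.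
  by apply/eqP; congr (\det _); apply/matrixP => i' j; rewrite !mxE.
set z := \sum_j c j * x j.
pose w : 'rV[M]_n := \row_i (c i * x i).
pose Uf := map_mx (\val : valuation_ring v -> M) U.
have wU : w *m Uf = \row_j s j z.
  apply/rowP => j; rewrite !mxE rmorph_sum; apply: eq_bigr => l _.
  have -> : Uf l j = s j (x l) / x l by rewrite mxE -Uv.
  by rewrite !mxE rmorphM /= ((sa j).2 (c l)) // -mulrA [x l * _]mulrC divfK.
(* The adjugate has integral entries and the determinant is a unit, so each [c i * x i] has value at
   least [v z]. *)
have : w *m Uf *m \adj Uf = (\det Uf) *: w by rewrite -mulmxA mul_mx_adj mul_mx_scalar.
rewrite wU => /(congr1 (fun A : 'rV[M]_n => A 0 i)); rewrite !mxE => e.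
have dUf : v (\det Uf) = Fin 0 by rewrite det_map_mx.
have -> : v (c i * x i) = v (\det Uf * (c i * x i)).
  by rewrite [RHS]val_mul dUf -[Fin 0]/(0 : withtop G) add0r.
rewrite -e; apply: v_sum_le => j _.
rewrite -map_mx_adj !mxE val_mul (aut_isometry sfK alg hens (sa j)).
rewrite -[X in X <= _]add0r [X in _ <= X]addrC; apply: withtop_le_add.
exact: vr_ge0.
Qed.

(** The matrix attached to the [p]-th powers is the Frobenius image of the given one, so its
    determinant is nonzero as well. *)
Lemma det_val_indep_pchar n (s : 'I_n -> {rmorphism M -> M}) (x : 'I_n -> M) p :
  p \in [pchar residue_field v] ->
  (forall j, field_automorphism K (s j)) -> (forall i, x i != 0) ->
  \det (\matrix_(i, j) res v (s j (x i) / x i)) != 0 -> val_indep K v (fun i => x i ^+ p).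
Proof.
move=> pp sa x0 det0; apply: (det_val_indep sa) => [i|]; first by rewrite expf_neq0.
rewrite (_ : \matrix_(i, j) _ = map_mx (pFrobenius_aut pp) (\matrix_(i, j) res v (s j (x i) / x i))).
  by rewrite det_map_mx fmorph_eq0.
apply/matrixP => i j; rewrite !mxE pFrobenius_autE rmorphXn -expr_div_n resX //.
by rewrite aut_ratio0.
Qed.

End DetIndep.

(** * A separability criterion through [p]-th powers *)

Section Separable.
Variables (k : fieldType) (k0 : set k) (sk0 : is_subfield k0).
Local Notation "p ^v" := (map_poly (@sf_val k k0 sk0) p) (at level 2, format "p ^v").

Lemma basis_algebraic (k1 : set k) n (u : 'I_n -> k) x : is_subfield k1 ->
  spans k0 k1 u -> k1 x -> is_algebraic k0 x.
Proof.
move=> s1 sp k1x; pose b (i : 'I_n.+1) := x ^+ i.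
have : ~ lin_indep k0 b.
  move=> /(indep_le_span sk0 (fun i => sfX s1 i k1x)) /(_ sp).
  by rewrite ltnn.
move=> /existsNP [c /not_implyP [kc /not_implyP [c0 /existsNP [i ci]]]].
exists (\poly_(i < n.+1) c (inord i)); split.
- by move=> j; rewrite coef_poly; case: ifP => // _; apply: sf0.
- apply: contra_notN ci => /eqP/(congr1 (fun p : {poly k} => p`_i)).
  by rewrite coef_poly ltn_ord inord_val coef0 => ->.
- rewrite rootE horner_poly -[X in _ == X]c0; apply/eqP/eq_bigr => j _.
  by rewrite inord_val.
Qed.

(* MacLane's criterion: an inseparable minimal polynomial g(X^p) would make the
   p-th powers of 1, x, ..., x^(deg g) dependent. *)
Lemma frobenius_separable (k1 : set k) n (u : 'I_n -> k) x : is_subfield k1 ->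
  spans k0 k1 u -> (forall p, p \in [pchar k] -> lin_indep k0 (fun i => u i ^+ p)) ->
  k1 x -> separable_over k0 x.
Proof.
move=> s1 sp frob k1x; have algx := basis_algebraic s1 sp k1x.
have [h [hE hm hP]] := minpoly_sfP sk0 algx.
rewrite /separable_over hE separable_map.
have szh : (1 < size h)%N by have := minpoly_size_gt1 sk0 algx; rewrite hE size_map_poly.
have h0 := monic_neq0 hm.
have [h'0|h'n0] := eqVneq h^`() 0; last first.
  (* A nonzero derivative makes the gcd smaller than [h], so the gcd does not vanish at [x]. Then
     the cofactor does, [h] divides it, and the gcd is constant. *)
  rewrite separable_poly.unlock /coprimep.
  have dh := dvdp_gcdl h h^`().
  have : (size (gcdp h h^`()) < size h)%N.
    apply: leq_ltn_trans (dvdp_leq h'n0 (dvdp_gcdr h h^`())) _.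
    exact: lt_size_deriv.
  case/dvdpP: dh => e he lt; have [e0 d0] : e != 0 /\ gcdp h h^`() != 0.
    by apply/andP; move: h0; rewrite {1}he mulf_eq0 negb_or.
  have : root (e * gcdp h h^`())^v x by rewrite -he hP.
  rewrite rmorphM rootM => /orP [|]; rewrite hP => hd; last first.
    by have := dvdp_leq d0 hd; rewrite leqNgt lt.
  have := dvdp_leq e0 hd; rewrite {1}he size_mul // => sz.
  rewrite eqn_leq size_poly_gt0 d0 andbT.
  by move: sz; rewrite -subn1 leq_subLR addnC leq_add2r.
(* A zero derivative means that the positive degree of the monic [h] vanishes in [k]. *)
have [p pp] : exists p, p \in [pchar k].
  apply: (@natf0_pchar _ (size h).-1); first by rewrite -ltnS prednK // ltnW.
  have := congr1 (fun q : {poly sf_type sk0} => q`_(size h).-2) h'0.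
  rewrite coef_deriv coef0 prednK; last by rewrite -ltnS prednK // ltnW.
  rewrite -lead_coefE (monicP hm) => /(congr1 (@sf_val k k0 sk0)).
  by rewrite rmorphMn rmorph1 rmorph0 => /eqP.
have p0 : (0 < p)%N := prime_gt0 (pcharf_prime pp).
have hdvd i : h`_i != 0 -> (p %| i)%N.
  case: i => // i hi; have := congr1 (fun q : {poly sf_type sk0} => q`_i) h'0.
  rewrite coef_deriv coef0 -mulr_natr => /(congr1 (@sf_val k k0 sk0)).
  rewrite rmorphM rmorph0 rmorph_nat => /eqP; rewrite mulf_eq0 fmorph_eq0 (negPf hi) /=.
  by rewrite -(dvdn_pcharf pp).
set d := (size h).-1.
have dE : d = (d %/ p * p)%N.
  by rewrite divnK // hdvd // -lead_coefE (monicP hm) oner_neq0.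
set d0 := (d %/ p)%N in dE.
have dgt : (0 < d)%N by rewrite -ltnS prednK // ltnW.
have d0d : (d0 < d)%N.
  rewrite [X in (_ < X)%N]dE ltn_Pmulr ?prime_gt1 ?(pcharf_prime pp) //.
  by move: dgt; rewrite dE muln_gt0 => /andP [].
have /choice [c cP] : forall i : 'I_d0.+1, exists c : 'I_n -> k, (forall j, k0 (c j)) /\ x ^+ i = \sum_j c j * u j.
  by move=> i; have [c kc xc] := sp _ (sfX s1 i k1x); exists c.
have [C CE] := @sf_mx _ _ sk0 _ _ (\matrix_(i, j) c i j) (fun i j => ltac:(by rewrite mxE; case: (cP i))).
have Cij i j : sf_val (C i j) = c i j by move/matrixP/(_ i j): CE; rewrite !mxE => ->.
(* A relation between the rows would give a nonzero polynomial of degree at most [d0 < d] vanishing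
   at [x]. *)
have freeC : row_free C.
  rewrite -kermx_eq0; apply/eqP/row_matrixP => i; rewrite row0.
  set w := row i _; have wC : w *m C = 0 by rewrite /w -row_mul mulmx_ker row0.
  pose q : {poly sf_type sk0} := rVpoly w.
  have : root q^v x.
    rewrite rootE (@horner_coef_wide _ d0.+1) ?size_map_poly ?size_poly //.
    apply/eqP; rewrite (eq_bigr (fun i : 'I_d0.+1 => \sum_j (sf_val (w 0 i) * c i j) * u j)); last first.
      move=> j _; rewrite coef_map /= coef_rVpoly_ord (cP j).2 mulr_sumr.
      by apply: eq_bigr => l _; rewrite mulrA.
    rewrite exchange_big big1 //= => l _; rewrite -mulr_suml.
    have := congr1 (fun A : 'rV_n => sf_val (A 0 l)) wC.
    rewrite !mxE raddf_sum rmorph0 => wC0.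
    rewrite [X in X * _](_ : _ = 0) ?mul0r // -[RHS]wC0; apply: eq_bigr => j _.
    by rewrite -Cij.
  rewrite hP => hq; have q0 : q = 0.
    apply/eqP; apply: contraTT hq => q0; apply/negP => /dvdp_leq -/(_ q0).
    rewrite leqNgt => /negP; apply; apply: leq_ltn_trans (size_poly _ _) _.
    by rewrite -ltnS prednK // in d0d; apply: ltnW.
  by rewrite -[w]rVpolyK -/q q0 linear0.
have pp' : p \in [pchar sf_type sk0] by rewrite -(fmorph_pchar (@sf_val k k0 sk0)).
have freeCp : row_free (map_mx (pFrobenius_aut pp') C) by rewrite row_free_map.
pose w : 'rV[sf_type sk0]_d0.+1 := \row_i h`_(i * p).
(* Only exponents divisible by [p] occur in [h]. Expanding its value 0 at [x] in the [u j ^+ p]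
   gives a relation between these independent elements. *)
have wC : w *m map_mx (pFrobenius_aut pp') C = 0.
  apply/rowP => j; apply: sf_val_inj; rewrite [in RHS]mxE rmorph0.
  apply: (frob p pp (fun j => sf_val ((w *m map_mx (pFrobenius_aut pp') C) 0 j))).
    by move=> l; apply: sf_val_in.
  pose g : {poly sf_type sk0} := \poly_(i < d0.+1) h`_(i * p).
  have hg : h = g \Po 'X^p.
    apply/polyP => i; rewrite coef_comp_poly_Xn //; case: ifPn => [/dvdnP [m ->]|]; last first.
      by apply: contraNeq => /hdvd.
    rewrite mulnK // coef_poly ltnS; case: leqP => // lt; apply: nth_default.
    have -> : size h = d.+1 by rewrite /d prednK // ltnW.
    by rewrite [X in (X < _)%N]dE ltn_pmul2r.
  have : h^v.[x] = 0 by apply/rootP; rewrite hP.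
  rewrite hg map_comp_poly map_polyXn horner_comp hornerXn.
  rewrite (@horner_coef_wide _ d0.+1) ?size_map_poly ?size_poly // => e.
  rewrite -[RHS]e.
  rewrite (eq_bigr (fun j => \sum_i sf_val (w 0 i) * (c i j * u j) ^+ p)); last first.
    move=> l _; rewrite mxE raddf_sum mulr_suml; apply: eq_bigr => i _.
    have e1 : sf_val (pFrobenius_aut pp' (C i l)) = c i l ^+ p.
      by rewrite pFrobenius_autE rmorphXn /= Cij.
    by rewrite exprMn mulrA -e1 [map_mx _ _ i l]mxE.
  rewrite exchange_big; apply: eq_bigr => i _ /=; rewrite -mulr_sumr.
  rewrite coef_map coef_poly ltn_ord mxE /= -exprM [(p * i)%N]mulnC exprM (cP i).2; congr (_ * _).
  rewrite -[RHS](pFrobenius_autE pp) rmorph_sum; apply: eq_bigr => l _.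
  by [].
have w0 : w = 0 by apply/eqP; rewrite -(mulmx_free_eq0 w freeCp) wC.
have := congr1 (fun A : 'rV_d0.+1 => A 0 ord_max) w0.
by rewrite !mxE /= -dE -lead_coefE (monicP hm) => /eqP; rewrite oner_eq0.
Qed.
End Separable.

(** * Valuation bases of extensions fixed by near-identity automorphisms *)

Section TameBasis.
Variables (M : closedFieldType) (K : set M) (sfK : is_subfield K).
Hypothesis alg : forall x, is_algebraic K x.
Variables (G : orderedGroupType) (v : valuation M G).
Hypothesis hens : henselian v K.
Variables (a : M) (sep : separable_over K a).
Variables (E : set M) (sE : is_subfield E) (KE : K `<=` E) (Ea : E `<=` adjoin K a).
Local Notation sT := (sf_type sfK).

(* In terms of the powers of a, the matrix (t_j b_i) is a row free matrix over K times
   a Vandermonde matrix, hence it has n independent columns. *)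
Lemma distinct_auts n (b : 'I_n -> M) : is_basis K E b ->
  exists s : 'I_n -> {rmorphism M -> M}, (forall i, field_automorphism K (s i)) /\
    forall i j, i != j -> exists2 x, E x & s i x <> s j x.
Proof.
move=> /(is_basisP sfK b (sf0 sE)) [Eb li _].
have [p [pE pm pP]] := minpoly_sfP sfK (alg a).
set p' := map_poly (@sf_val M K sfK) p in pE.
have p'm : p' \is monic by rewrite map_monic.
have [r] := closed_field_poly_normal p'; rewrite (monicP p'm) scale1r => p'r.
have ur : uniq r by rewrite -separable_prod_XsubC -p'r -pE.
pose N := (size p').-1.
have szr : size r = N by rewrite /N p'r size_prod_XsubC.
have /choice [t tP] : forall j : 'I_N, exists t : {rmorphism M -> M},
    field_automorphism K t /\ t a = r`_j.
  move=> j; have cj : conjugate K a r`_j.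
    by rewrite /conjugate pE p'r root_prod_XsubC mem_nth // szr.
  by have [t [ta _ taj]] := conjugate_aut sfK alg sfK (@subset_refl _ K) cj; exists t.
have /choice [c cP] : forall i, exists c : 'I_N -> M,
    (forall k, K (c k)) /\ b i = \sum_k c k * a ^+ k.
  move=> i; have [q sq bq] := adjoin_small sfK alg (Ea (Eb i)).
  exists (fun k => (map_poly (@sf_val M K sfK) q)`_k); split=> [k|].
    by rewrite coef_map; apply: sf_val_in.
  rewrite bq (@horner_coef_wide _ N) // size_map_poly -ltnS /N prednK -?pE //.
  by rewrite (leq_ltn_trans _ sq).
have Bex : exists B : 'M[sT]_(n, N), \matrix_(i, k) c i k = map_mx (@sf_val M K sfK) B.
  by apply: sf_mx => i k; rewrite mxE; case: (cP i).
have [B BE] := Bex.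
have Bik i k : sf_val (B i k) = c i k by move/matrixP/(_ i k): BE; rewrite !mxE => ->.
have freeB : row_free B.
  rewrite -kermx_eq0; apply/eqP/row_matrixP => i; rewrite row0.
  set w := row i _; have wB : w *m B = 0 by rewrite /w -row_mul mulmx_ker row0.
  apply/rowP => j; rewrite [RHS]mxE; apply: sf_val_inj; rewrite rmorph0.
  apply: (li (fun j => sf_val (w 0 j))) => [l|]; first exact: sf_val_in.
  rewrite (eq_bigr (fun i => \sum_k (sf_val (w 0 i) * c i k) * a ^+ k)); last first.
    by move=> l _; rewrite (cP l).2 mulr_sumr; apply: eq_bigr => k _; rewrite mulrA.
  rewrite exchange_big big1 //= => k _; rewrite -mulr_suml.
  have := congr1 (fun A : 'rV_N => sf_val (A 0 k)) wB.
  rewrite !mxE raddf_sum rmorph0 => wB0.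
  rewrite [X in X * _](_ : _ = 0) ?mul0r // -[RHS]wB0; apply: eq_bigr => l _.
  by rewrite -Bik.
pose V := Vandermonde N (\row_(j < N) r`_j).
have V_unit : row_free V.
  rewrite row_free_unit unitmxE unitfE det_Vandermonde.
  apply/prodf_neq0 => i _; apply/prodf_neq0 => j ij.
  rewrite !mxE subr_eq0 nth_uniq ?szr //.
  by rewrite neq_ltn ij orbT.
pose W : 'M[M]_(n, N) := \matrix_(i, j) t j (b i).
have WE : W = map_mx (@sf_val M K sfK) B *m V.
  apply/matrixP => i j; rewrite !mxE (cP i).2 rmorph_sum; apply: eq_bigr => k _.
  rewrite !mxE Bik rmorphM rmorphXn /= (tP j).2; congr (_ * _).
  by apply: (tP j).1.2; case: (cP i).
have fullW : row_full W^T.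
  rewrite /row_full mxrank_tr WE mxrankMfree //.
  by rewrite mxrank_map; exact: freeB.
have freeW : row_free (rowsub (fullrankfun fullW) W^T).
  by rewrite row_free_unit -row_full_unit fullrowsub_full.
exists (fun i => t (fullrankfun fullW i)); split=> [i|i j ij].
  exact: (tP _).1.
(* Two automorphisms agreeing on [E] agree on all [b l] and would give two equal rows of a free
   matrix. *)
apply: contrapT => same; case/eqP: ij.
have rij : row i (rowsub (fullrankfun fullW) W^T) = row j (rowsub (fullrankfun fullW) W^T).
  apply/rowP => l; rewrite !mxE; apply: contrapT => ne; apply: same; exists (b l) => //.
have := row_free_inj freeW; move=> /(_ 1%N (delta_mx 0 i) (delta_mx 0 j)).
rewrite -!rowE => /(_ rij) /matrixP /(_ 0 i); have [//|ne] := eqVneq i j.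
by rewrite !mxE !eqxx (negPf ne) => /eqP; rewrite oner_eq0.
Qed.

Hypothesis Eram : forall x, E x -> forall t, near_identity K v t -> t x = x.

(** The characters sending [x] to the residue of [s j x / x] are pairwise distinct on the nonzero
    elements of [E]. Dedekind's argument yields [n] valuation-independent elements, and these span
    [E] by dimension. *)
Lemma tame_basis n (b : 'I_n -> M) : is_basis K E b ->
  exists x : 'I_n -> M, [/\ forall i, E (x i), forall i, x i != 0, is_basis K E x,
    val_indep K v x &
    forall p, p \in [pchar residue_field v] -> val_indep K v (fun i => x i ^+ p)].
Proof.
move=> bb; have [s [sa dist]] := distinct_auts bb.
pose S := [set x | E x /\ x != 0].
have [||j|j x y [_ x0] [_ y0]|i j ij|x [Sx det0]] :=
    @dedekind_det _ _ S _ _ n (fun j x => res v (s j x / x)).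
- by split; [exact: sf1|exact: oner_neq0].
- by move=> x y [Ex x0] [Ey y0]; split; [exact: sfM|rewrite mulf_neq0].
- by rewrite rmorph1 divr1 res1.
- rewrite rmorphM -mulf_div resM // (aut_ratio0 sfK alg hens) //.
(* If the characters of [s i] and [s j] agree, the inverse of [s j] composed with [s i] preserves
   leading terms on [E]. It then fixes [E], whereas [s i] and [s j] differ at [x0]. *)
- apply: contrapT => same; have [x0 Ex0 nex] := dist i j ij; case: nex.
  have [t [ta tj jt]] := aut_inv sfK alg (sa j).
  have ca : field_automorphism K (t \o s i) by apply: aut_comp.
  have := ramification_trivial sfK alg hens sE KE ca _ Ex0 (Eram Ex0) => /= h.
  rewrite -{2}h ?jt // => x Ex xn0; apply: contrapT => nn; apply: same.
  exists x; first by split.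
  apply/negP => /eqP e; apply: nn; rewrite /near.
  rewrite -(aut_lt hens (sa j)) rmorphB jt (aut_isometry sfK alg hens (sa j)).
  have : res v (s i x / x - s j x / x) == 0 by rewrite resB ?e ?subrr ?(aut_ratio0 sfK alg hens).
  rewrite res_eq0; last by rewrite v_sub_le ?(aut_ratio0 sfK alg hens).
  rewrite -mulrBl => h'; have : v (x * 1) < v (x * ((s i x - s j x) / x)).
    by rewrite v_lt_mul2l // (Defs.val1 v).
  by rewrite mulr1 mulrCA mulfV // mulr1.
have Ex i : E (x i) by case: (Sx i).
have x0 i : x i != 0 by case: (Sx i).
have vi := det_val_indep sfK alg hens sa x0 det0.
have li := val_indep_indep x0 vi.
exists x; split=> //.
- apply/(is_basisP sfK x (sf0 sE)); split=> //.
  have [_ _ sp] := (is_basisP sfK b (sf0 sE)).1 bb.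
  apply: (indep_spans sfK) sp Ex li => [y z|y z Ky|].
  + exact: sfD.
  + by move=> Ez; apply: (sfM sE) => //; apply: KE.
  + exact: sf0.
- by move=> p pp; apply: (det_val_indep_pchar sfK alg hens pp sa x0 det0).
Qed.
End TameBasis.

(** * Counting cosets of value groups *)

Lemma card_set_seq (T : eqType) (s : seq T) : uniq s -> [set` s] #= `I_(size s).
Proof.
case: s => [|x0 s']; first by move=> _; rewrite (_ : [set` _] = set0) ?II0 //; apply/seteqP; split.
move: (x0 :: s') => {s'} s us.
rewrite (_ : [set` s] = nth x0 s @` `I_(size s)); last first.
  apply/seteqP; split=> [x /= xs|_ [i /= ilt <-]]; last exact: mem_nth.
  by exists (index x s); [rewrite /= index_mem|rewrite nth_index].
apply: inj_card_eq => i j; rewrite !inE /= => ilt jlt /eqP.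
by rewrite nth_uniq // => /eqP.
Qed.

Section Cauchy.
Import fingroup pgroup finalg.

(* Cauchy's theorem for B / A, where rep is a system of representatives. *)
Lemma cauchy_reps (G : zmodType) (A B : set G) e (rep : 'I_e -> G) p :
  A 0 -> (forall g h, A g -> A h -> A (g - h)) ->
  B 0 -> (forall g h, B g -> B h -> B (g - h)) ->
  (forall i, B (rep i)) -> (forall i j, A (rep i - rep j) -> i = j) ->
  (forall g, B g -> exists k, A (g - rep k)) ->
  prime p -> (p %| e)%N -> exists i, ~ A (rep i) /\ A (rep i *+ p).
Proof.
move=> A0 AB B0 BB Brep inj ex pp pe.
have BN g : B g -> B (- g) by move=> Bg; rewrite -sub0r; apply: BB.
have BD g h : B g -> B h -> B (g + h) by move=> Bg Bh; rewrite -[h]opprK; apply/BB/BN.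
have AN g : A g -> A (- g) by move=> Ag; rewrite -sub0r; apply: AB.
have AD g h : A g -> A h -> A (g + h) by move=> Ag Ah; rewrite -[h]opprK; apply/AB/AN.
have [z _] := ex 0 B0.
have /choice [cl clP] : forall g, exists k, B g -> A (g - rep k).
  by move=> g; have [/ex [k]|nB] := pselect (B g); [exists k|exists z].
have clE g h : B g -> B h -> A (g - h) -> cl g = cl h.
  move=> Bg Bh gh; apply: inj.
  have := AD _ _ (AB _ _ gh (clP g Bg)) (clP h Bh).
  by rewrite opprB [g - h + _]addrC subrKA subrKA.
have repK : cancel rep cl by move=> i; apply: inj; rewrite -opprB; apply/AN/clP.
have Bcl g : B (rep (cl g)) by [].
have clDl g h : B g -> B h -> cl (rep (cl g) + h) = cl (g + h).
  move=> Bg Bh; apply: clE; [exact: BD|exact: BD|].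
  by rewrite opprD addrACA subrr addr0 -opprB; apply/AN/clP.
have clDr g h : B g -> B h -> cl (h + rep (cl g)) = cl (h + g).
  by move=> Bg Bh; rewrite addrC clDl // addrC.
(* The group law of the quotient is transported to the index set, so that Cauchy's theorem for
   finite groups applies. *)
pose add i j := cl (rep i + rep j).
have addA : associative add.
  by move=> i j k; rewrite /add clDl ?clDr ?addrA //; apply: BD.
have addC : commutative add by move=> i j; rewrite /add addrC.
have add0 : left_id (cl 0) add by move=> i; rewrite /add clDl // add0r repK.
have addN : left_inverse (cl 0) (fun i => cl (- rep i)) add.
  by move=> i; rewrite /add clDl ?addNr //; apply: BN.
pose Z : finZmodType := HB.pack_for finZmodType 'I_e
  (GRing.isZmodule.Build 'I_e addA addC add0 addN).
have cZ : #|[set: Z]%G| = e by rewrite cardsT; exact: card_ord.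
have [|x _ ox] := @Cauchy Z p [set: Z]%G pp; first by rewrite cZ.
have mulrnE n : (x *+ n)%R = cl (rep x *+ n) :> 'I_e.
  elim: n => [|n IH]; first by rewrite !mulr0n.
  rewrite !mulrS -clDr //; last by elim: n {IH} => [|n IH]; rewrite ?mulr0n ?mulrS //; apply: BD.
  by rewrite -IH.
have zero : cl 0 = 0%R :> Z by [].
exists x; split.
- move=> Ax; move: ox; rewrite (_ : x = 1%g) ?order1; first by move=> p1; move: pp; rewrite -p1.
  by change (x = cl 0); rewrite -(repK x); apply: clE => //; rewrite subr0.
- have : (x *+ p)%R = 0%R :> Z by rewrite -FinRing.zmodXgE -ox expg_order.
  have Bp n : B (rep x *+ n).
    by elim: n => [|n IH]; rewrite ?mulr0n ?mulrS //; apply: BD.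
  rewrite mulrnE => e0; have := clP _ (Bp p); rewrite e0 => h.
  have := AD _ _ h (AN _ (clP 0 B0)); rewrite -zero opprB.
  by rewrite subr0 subrK.
Qed.

End Cauchy.

Section Counting.
Variables (M : fieldType) (K : set M) (sfK : is_subfield K).
Variables (G : orderedGroupType) (v : valuation M G).
Local Notation Gam := (value_group v K).
Local Notation kK := (residue_subfield (v := v) K).

(** The value as an element of [G], with default 0 at [x = 0]. *)
Definition fin_val (x : M) : G := if v x is Fin g then g else 0.

Lemma fin_valE x : x != 0 -> v x = Fin (fin_val x).
Proof. by move=> /(v_fin v) [g xg]; rewrite /fin_val xg. Qed.

Lemma fin_valM x y : x != 0 -> y != 0 -> fin_val (x * y) = fin_val x + fin_val y.
Proof. by move=> /(v_fin v) [g xg] /(v_fin v) [h yh]; rewrite /fin_val val_mul xg yh. Qed.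

Lemma fin_val1 : fin_val 1 = 0. Proof. by rewrite /fin_val (Defs.val1 v). Qed.

Lemma fin_valV x : x != 0 -> fin_val x^-1 = - fin_val x.
Proof.
by move=> x0; apply: (addrI (fin_val x)); rewrite subrr -fin_valM ?invr_eq0 // mulfV // fin_val1.
Qed.

Lemma fin_valX x n : x != 0 -> fin_val (x ^+ n) = fin_val x *+ n.
Proof.
move=> x0; elim: n => [|n IH]; first by rewrite fin_val1.
by rewrite exprS fin_valM ?expf_neq0 // IH mulrS.
Qed.

Lemma value_groupP (E : set M) g : value_group v E g <-> exists x, [/\ E x, x != 0 & g = fin_val x].
Proof.
split=> [[x Ex xg]|[x [Ex x0 ->]]]; last by exists x => //; apply: fin_valE.
by exists x; split=> //; [rewrite -(v_ltInfty v) xg|rewrite /fin_val xg].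
Qed.

Lemma value_group0 (E : set M) : is_subfield E -> value_group v E 0.
Proof.
by move=> sE; apply/value_groupP; exists 1; split; [exact: sf1|exact: oner_neq0|rewrite fin_val1].
Qed.

Lemma value_groupB (E : set M) g h : is_subfield E ->
  value_group v E g -> value_group v E h -> value_group v E (g - h).
Proof.
move=> sE /value_groupP [x [Ex x0 ->]] /value_groupP [y [Ey y0 ->]].
apply/value_groupP; exists (x / y); split; first exact: sf_div.
  by rewrite mulf_neq0 ?invr_eq0.
by rewrite fin_valM ?invr_eq0 // fin_valV.
Qed.

Definition coset g : set G := [set g + h | h in Gam].

Lemma coset_eq g h : coset g = coset h <-> Gam (g - h).
Proof.
have G0 := value_group0 sfK.
split=> [e|gh].
  have : coset g g by exists 0; rewrite ?addr0.
  by rewrite e => -[k Gk <-]; rewrite addrAC subrr add0r.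
apply/seteqP; split=> _ [k Gk <-].
  exists (g - h + k); last by rewrite addrA subrKC.
  by rewrite -[k]opprK; apply: value_groupB => //; rewrite -sub0r; apply: value_groupB.
by exists (k - (g - h)); [apply: value_groupB|rewrite opprB addrCA subrKC addrC].
Qed.

Variables (E : set M) (sE : is_subfield E) (KE : K `<=` E).

(** If no term of the expansion had value [v z], all terms, and hence their sum [z], would have
    larger value. *)
Lemma leading_term n (x : 'I_n -> M) z : spans K E x -> val_indep K v x ->
  E z -> z != 0 -> exists i, exists2 c, K c & v z = v (c * x i).
Proof.
move=> sp vi Ez z0; have [c Kc zc] := sp _ Ez.
apply: contrapT => no; have : v z < v (\sum_i c i * x i).
  apply: v_sum_lt => [|i _]; first by rewrite v_ltInfty.
  rewrite lt_neqAle {2}zc vi // andbT; apply/eqP => e; apply: no; exists i; exists (c i) => //.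
by rewrite -zc ltxx.
Qed.

Lemma leading_class n (x : 'I_n -> M) z : spans K E x -> val_indep K v x ->
  (forall i, x i != 0) -> E z -> z != 0 -> exists i, Gam (fin_val z - fin_val (x i)).
Proof.
move=> sp vi x0 Ez z0; have [i [c Kc zc]] := leading_term sp vi Ez z0.
exists i; have cx0 : c * x i != 0 by rewrite -(v_ltInfty v) -zc v_ltInfty.
have c0 : c != 0 by apply: contraNneq cx0 => ->; rewrite mul0r.
apply/value_groupP; exists c; split=> //.
by rewrite /fin_val zc -/(fin_val (c * x i)) fin_valM // addrK.
Qed.

Variables (n : nat) (x : 'I_n -> M).
Hypotheses (Ex : forall i, E (x i)) (x0 : forall i, x i != 0) (bx : is_basis K E x).
Hypothesis vi : val_indep K v x.

Let sp : spans K E x.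
Proof. by case: ((is_basisP sfK x (sf0 sE)).1 bx). Qed.

Let cl i := coset (fin_val (x i)).
Let s := undup (map cl (enum 'I_n)).

(** Dividing the family by [x i0] turns the class of [i0] into the indices with value in that of
    [K], which index a basis of the residue extension. *)
Lemma class_card i0 : #|[set i | cl i == cl i0]%SET| = inertia_degree v K E.
Proof.
have y0 i : x i * (x i0)^-1 != 0 by rewrite mulf_neq0 ?invr_eq0.
have [d [_ _ _ bb]] := residue_basis sfK sE KE (fun i => sf_div sE (Ex i) (Ex i0)) y0
  (spans_scale sE (sfV sE (Ex i0)) (invr_neq0 (x0 i0)) sp) (val_indep_scale (x i0)^-1 vi).
have sk := residue_is_subfield v sfK.
rewrite /inertia_degree (ext_degreeE sk (sf0 (residue_is_subfield v sE)) bb).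
apply: eq_card => i; rewrite !inE; apply/eqP/asboolP => [/coset_eq|[c Kc vc]].
  move=> /value_groupP [c [Kc c0 gc]]; exists c => //.
  by rewrite (fin_valE c0) (fin_valE (y0 i)) fin_valM ?invr_eq0 // fin_valV // gc.
apply/coset_eq; apply/value_groupP; exists c.
have c0 : c != 0 by rewrite -(v_ltInfty v) vc v_ltInfty.
split=> //; rewrite -fin_valV // -fin_valM ?invr_eq0 //.
by rewrite /fin_val vc.
Qed.

Lemma value_cosets : [set coset g | g in value_group v E] = [set` s].
Proof.
apply/seteqP; split=> [_ [g /value_groupP [z [Ez z0 ->]] <-]|C /=].
  have [i zi] := leading_class sp vi x0 Ez z0.
  rewrite /= mem_undup; apply/mapP; exists i; first by rewrite mem_enum.
  exact/coset_eq.
rewrite mem_undup => /mapP [i _ ->]; exists (fin_val (x i)) => //.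
by apply/value_groupP; exists (x i).
Qed.

Lemma ramification_indexE : ramification_index v K E = size s.
Proof.
rewrite /ramification_index; apply: xget_unique.
  by rewrite /= -/coset value_cosets; apply/card_set_seq/undup_uniq.
move=> m /=; rewrite value_cosets => sm; apply/card_eq_II.
by rewrite -(card_eql sm); apply/card_set_seq/undup_uniq.
Qed.

(** Group the indices by the coset of their value: there are as many classes as the ramification
    index, each of size the inertia degree. *)
Lemma valuation_basis_card : n = (ramification_index v K E * inertia_degree v K E)%N.
Proof.
have cs i : cl i \in s by rewrite mem_undup map_f // mem_enum.
pose f (i : 'I_n) : 'I_(size s) := Ordinal (etrans (index_mem _ _) (cs i)).
rewrite ramification_indexE -[LHS]card_ord -sum1_card (partition_big f xpredT) //=.
rewrite (eq_bigr (fun=> inertia_degree v K E)); first by rewrite sum_nat_const card_ord.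
move=> j _; have : nth (set0 : set G) s j \in s by apply: mem_nth.
rewrite mem_undup => /mapP [i0 _ ji0].
have fE i : (f i == j) = (cl i == cl i0).
  rewrite -ji0 -val_eqE /= -(nth_uniq set0 _ (ltn_ord j) (undup_uniq _)) ?index_mem //.
  by rewrite nth_index.
by rewrite sum1_card -(class_card i0); apply: eq_card => i; rewrite [RHS]inE -fE.
Qed.

(** The [p]-th powers also form a valuation-independent spanning family, so multiplication by [p] is
    surjective on the finite quotient of the value groups, hence injective. This excludes the
    element of order [p] that Cauchy's theorem would give. *)
Lemma ramification_coprime p : prime p -> val_indep K v (fun i => x i ^+ p) ->
  coprime (ramification_index v K E) p.
Proof.
move=> pp vip; rewrite coprime_sym prime_coprime // ramification_indexE; apply/negP => pe.
have jP (j : 'I_(size s)) : exists i, cl i = nth set0 s j.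
  have : nth (set0 : set G) s j \in s by apply: mem_nth.
  by rewrite mem_undup => /mapP [i0 _ ji0]; exists i0.
have [c cP] := choice jP.
pose rep j := fin_val (x (c j)).
have Brep j : value_group v E (rep j) by apply/value_groupP; exists (x (c j)).
have inj i j : Gam (rep i - rep j) -> i = j.
  move/coset_eq; rewrite -/(cl (c i)) -/(cl (c j)) !cP => /eqP.
  by rewrite nth_uniq ?undup_uniq // => /eqP /val_inj.
have clrep i : exists j, Gam (fin_val (x i) - rep j).
  have cs : cl i \in s by rewrite mem_undup map_f // mem_enum.
  have lt : (index (cl i) s < size s)%N by rewrite index_mem.
  exists (Ordinal lt); apply/coset_eq; rewrite -/(cl i) -/(cl (c (Ordinal lt))) cP /=.
  by rewrite nth_index.
have AD g h : Gam g -> Gam h -> Gam (g + h).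
  move=> Ag Ah; rewrite -[h]opprK; apply: value_groupB => //; rewrite -sub0r.
  by apply: value_groupB => //; apply: value_group0.
have ex g : value_group v E g -> exists k, Gam (g - rep k).
  move=> /value_groupP [z [Ez z0 ->]].
  have [i zi] := leading_class sp vi x0 Ez z0; have [j ij] := clrep i.
  by exists j; have := AD _ _ zi ij; rewrite addrA subrK.
have [i [ni ip]] := cauchy_reps (value_group0 sfK) (fun g h => value_groupB sfK)
  (value_group0 sE) (fun g h => value_groupB sE) Brep inj ex pp pe.
have xp0 i' : x i' ^+ p != 0 by rewrite expf_neq0.
have spp : spans K E (fun i => x i ^+ p).
  apply: (indep_spans sfK) sp (fun i => sfX sE p (Ex i)) (val_indep_indep xp0 vip) => [y z|y z Ky Ez|].
  - exact: sfD.
  - by apply: (sfM sE) => //; apply: KE.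
  - exact: sf0.
have AMn g k : Gam g -> Gam (g *+ k).
  by move=> Ag; elim: k => [|k IH]; rewrite ?mulr0n ?mulrS; [exact: value_group0|apply: AD].
(* The map [t] divides a class by [p]; being injective on a finite set, it is a bijection. *)
have /choice [t tP] : forall j, exists k, Gam (rep j - rep k *+ p).
  move=> j; have [i' ji'] := leading_class spp vip xp0 (Ex (c j)) (x0 (c j)).
  have [k ik] := clrep i'; exists k.
  rewrite fin_valX // in ji'; have := AD _ _ ji' (AMn _ p ik).
  by rewrite mulrnBl addrA subrK.
have t_inj : injective t.
  move=> j j' e; apply: inj; have := value_groupB sfK (tP j) (tP j').
  by rewrite e opprB addrA subrK.
have [t' _ tt'] := injF_bij t_inj.
have [z Gz] := ex 0 (value_group0 sE).
have Gz' : Gam (rep z).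
  by have := value_groupB sfK (value_group0 sfK) Gz; rewrite opprB subr0 add0r.
(* The class [t' j] is [p] times the class [j], so it is the trivial class [z] when [j] is killed by
   [p]. *)
have h j : Gam (rep j *+ p) -> t' j = z.
  move=> jp; apply: inj; have := tP (t' j); rewrite tt' => /AD /(_ jp); rewrite subrK => h.
  exact: value_groupB.
apply: ni; rewrite (_ : i = z) //.
by rewrite -(tt' i) (h i ip) -{1}(h z (AMn _ p Gz')) tt'.
Qed.

(** The residue basis is obtained from the [x i] with value in that of [K]. Independence of the
    [x i ^+ p] makes the [p]-th powers of this basis independent. *)
Lemma residue_separable : (forall p, p \in [pchar residue_field v] -> val_indep K v (fun i => x i ^+ p)) ->
  forall xi, residue_subfield (v := v) E xi -> separable_over kK xi.
Proof.
move=> vip xi Exi; have sk := residue_is_subfield v sfK; have sk1 := residue_is_subfield v sE.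
have [d [Kd d0 vd bb]] := residue_basis sfK sE KE Ex x0 sp vi.
have [_ _ spu] := (is_basisP sk _ (sf0 sk1)).1 bb.
apply: (frobenius_separable sk sk1 spu) => // p pp.
have p0 j : v (x (enum_val j) ^+ p) = v (d j ^+ p) by apply: v_pow_eq.
have := residue_indep sfK (d := fun j => d j ^+ p) (@enum_val_inj _ _)
  (fun j => sfX sfK p (Kd j)) (fun j => expf_neq0 p (d0 j)) p0 (vip p pp).
rewrite (_ : (fun j => res v (x (enum_val j) ^+ p / d j ^+ p)) = (fun j => res v (x (enum_val j) / d j) ^+ p)) //.
apply/funext => j; rewrite -expr_div_n resX //.
by rewrite mulrC (v_eq_mul _ (vd j)) mulVf // (Defs.val1 v).
Qed.

End Counting.

(** Automorphisms that fix [a] fix every subextension [E], which therefore has a valuation basis;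
    its three consequences are the three conditions of tameness. *)
Lemma tame_of_fixed (M : closedFieldType) (K : set M) (G : orderedGroupType) (v : valuation M G) a :
  is_subfield K -> (forall x, is_algebraic K x) -> henselian v K -> separable_over K a ->
  (forall t, near_identity K v t -> t a = a) -> tame_extension v K (adjoin K a).
Proof.
move=> sfK alg hens sep afix E sE KE Ea [n [b bb]].
have fixE x : E x -> forall t, near_identity K v t -> t x = x.
  move=> /Ea /(adjoin_small sfK alg) [q _ ->] t tr.
  by rewrite (aut_horner _ _ tr.1) afix.
have [x [Ex x0 bx vi vip]] := tame_basis sfK alg hens sep sE KE Ea fixE bb.
have card := valuation_basis_card sfK sE KE Ex x0 bx vi.
split.
(* In residue characteristic 0 the exponent has its default value 1. *)
- rewrite /char_exponent; case: xgetP => [p _ pp|_]; last by rewrite coprimen1.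
  exact: (ramification_coprime sfK sE KE Ex x0 bx vi (pcharf_prime pp) (vip _ pp)).
- exact: (residue_separable sfK sE KE Ex x0 bx vi vip).
- by rewrite /has_defect muln1 -card (ext_degreeE sfK (sf0 sE) bx).
Qed.

Theorem corollary1p5 (Kbar : closedFieldType) (K : set Kbar)
    (G : orderedGroupType) (v : valuation Kbar G) (a : Kbar)
    (K_subfield : is_subfield K)
    (Kbar_algebraic : forall x, is_algebraic K x)
    (v_nontrivial : nontrivial_on v K)
    (v_henselian : henselian v K)
    (a_separable : separable_closure K a)
    (a_notin_K : ~ K a)
    (a_pure : pure v K a)
    (Ka_not_tame : ~ tame_extension v K (adjoin K a))
    (L := adjoin K a `&` ramification_field v K)
    (Ka_minimal : minimal_extension L (adjoin K a)) :
  let cond := exists m, is_max (distances v K a) m /\ conj_distances v K a m in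
  (cond -> conj_distances v K a #= `I_2) /\
  (~ cond -> conj_distances v K a #= `I_1).
Proof.
pose aut := @field_automorphism Kbar K.
have [t [[ta tnear] t_a]] : exists t, near_identity K v t /\ t a <> a.
  apply: contrapT => no; apply: Ka_not_tame.
  apply: (tame_of_fixed K_subfield Kbar_algebraic v_henselian (proj2 a_separable)).
  by move=> t tn; apply: contrapT => t_a; apply: no; exists t.
have LKa : L `<=` adjoin K a by move=> x [].
have fixL (s : {rmorphism Kbar -> Kbar}) : aut s ->
    (forall c, K c -> v (a - c) < v (s a - a)) -> forall x, L x -> s x = x.
  move=> sa far x [Ax [_ xfix]].
  apply: (ramification_trivial K_subfield Kbar_algebraic v_henselian
    (adjoin_subfield K a) (@sub_adjoin _ K a) sa _ Ax).
    exact: (pure_trivial K_subfield Kbar_algebraic).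
  by move=> u /near_identity_ramification; apply: xfix.
have tL x : L x -> t x = x.
  by move=> [_ [_]]; apply; apply: near_identity_ramification.
(* The automorphism [t] keeps the leading term of [a - c], and [t a - a] is the difference of
   [t (a - c)] and [a - c]. *)
have far c : K c -> v (a - c) < v (t a - a).
  move=> Kc; have ac : a - c != 0.
    by rewrite subr_eq0; apply/eqP => ac; apply: a_notin_K; rewrite ac.
  by have := tnear _ ac; rewrite /near rmorphB (ta.2 c Kc) opprB addrA subrK.
have distE m : conj_distances v K a m <->
    exists s : {rmorphism Kbar -> Kbar}, [/\ aut s, s a <> a & m = v (s a - a)].
  split=> [[b [cb ba] <-]|[s [sa s_a ->]]].
    have [s [sa _ sb]] := conjugate_aut K_subfield Kbar_algebraic K_subfield (@subset_refl _ K) cb.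
    by exists s; rewrite sb v_subC; split.
  exists (s a); last by rewrite v_subC.
  by split=> //; apply: (aut_conjugate K_subfield Kbar_algebraic).
(* By isometry [s (a - c)] and [a - c] have the same value, and [s a - a] is their difference. *)
have below (s : {rmorphism Kbar -> Kbar}) c : aut s -> K c -> v (a - c) <= v (s a - a).
  move=> sa Kc; rewrite (_ : s a - a = s (a - c) - (a - c)).
    by rewrite v_sub_le // (aut_isometry K_subfield Kbar_algebraic v_henselian sa).
  by rewrite rmorphB (sa.2 c Kc) opprB addrA subrK.
have dist (s : {rmorphism Kbar -> Kbar}) : aut s -> s a <> a ->
    v (s a - a) = v (t a - a) \/ is_max (distances v K a) (v (s a - a)).
  move=> sa s_a; have [sL|nL] := pselect (forall x, L x -> s x = x).
    (* Both [s] and [t] fix [L] and move [a], so the comparison holds with their roles exchanged. *)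
    left; apply/le_anti/andP; split;
      exact: (minimal_distance K_subfield Kbar_algebraic v_henselian LKa Ka_minimal).
  (* Otherwise [s a] would be closer to [a] than every element of [K], and [s] would fix [L]. *)
  right; have [c Kc cs] : exists2 c, K c & v (s a - a) <= v (a - c).
    apply: contrapT => no; apply: nL; apply: fixL => // c Kc.
    by rewrite ltNge; apply/negP => le; apply: no; exists c.
  split=> [|_ [c' Kc' <-]]; last exact: below.
  by exists c => //; apply/le_anti; rewrite cs below.
have tdist : conj_distances v K a (v (t a - a)) by apply/distE; exists t.
split=> [[m [mmax mconj]]|ncond].
(* The maximum is attained at an element of [K], hence lies strictly below [v (t a - a)]: the two
   distances are distinct. *)
- have mlt : v (t a - a) != m.
    by case: mmax => -[c Kc <-] _; rewrite neq_lt far // orbT.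
  rewrite (_ : conj_distances v K a = [set` [:: v (t a - a); m]]).
    by apply: card_set_seq; rewrite /= inE mlt.
  apply/seteqP; split=> [d /distE [s [sa s_a ->]]|d] /=.
    rewrite !inE; have [->|smax] := dist s sa s_a; first by rewrite eqxx.
    apply/orP; right; apply/eqP/le_anti/andP.
    by split; [apply: mmax.2 smax.1|apply: smax.2 mmax.1].
  by rewrite !inE => /orP [/eqP ->|/eqP ->].
- rewrite (_ : conj_distances v K a = [set` [:: v (t a - a)]]).
    exact: card_set_seq.
  apply/seteqP; split=> [d dd|d] /=; last by rewrite !inE => /eqP ->.
  have [s [sa s_a ds]] := (distE d).1 dd; rewrite !inE ds.
  have [->//|smax] := dist s sa s_a.
  by case: ncond; exists (v (s a - a)); rewrite -{2}ds.
Qed.
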